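(* Work in the Soft-BCT model described in the context, with $\bm W$, the observed series $\bm x$ and the initial context fixed. Let $\{\pi^{\circ}_{t,s,s_m}\}$ be current branching probabilities, and let $\bm\Lambda'_s,\bm\mu'_s,a'_s,b'_s,g'_s$ $(s\in\mathcal S_{\max})$ and the current variational distribution $q(T,\bm\theta,\bm\tau)=q(T)\prod_{s\in\mathcal L_T}q(\bm\theta_s,\tau_s)$ be obtained from them as described in the context. Let $q(\bm U)$ be the probability mass function on sequences $\bm U=\{\bm U_t\}_{t=1}^n$ of context matrices determined by $$\ln q(\bm U)=\mathbb E_{q(T,\bm\theta,\bm\tau)}\bigl[\ln p(\bm x,\bm U,T,\bm\theta,\bm\tau\mid\bm W)\bigr]+\mathrm{const.},$$ where const. does not depend on $\bm U$. Then $q(\bm U)=\prod_{t=1}^n q(\bm U_t)$, and for each $t$ $$q(\bm U_t)=\prod_{s\in\mathcal I_{\max}}\prod_{m=1}^M(\pi'_{t,s,s_m})^{I\{s_m\preceq \mathsf s(\bm U_t)\}},\qquad \pi'_{t,s,s_m}:=\frac{\rho_{t,s,s_m}}{\sum_{m'=1}^M\rho_{t,s,s_{m'}}},$$ where $\rho_{t,s,s_m}>0$ is defined recursively (from the deepest nodes upward) by $$\ln\rho_{t,s,s_m}:=\begin{cases}\ln\sigma_m(\bm W_s\bm x_t^{\mathrm L})+(\star)_{t,s_m}+\ln\sum_{s_{\mathrm{ch}}\in\mathrm{Ch}(s_m)}\rho_{t,s_m,s_{\mathrm{ch}}}, & s_m\in\mathcal I_{\max},\\ \ln\sigma_m(\bm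 W_s\bm x_t^{\mathrm L})+(\star)_{t,s_m}, & s_m\in\mathcal L_{\max},\end{cases}$$ with $$(\star)_{t,s_m}=\frac12(1-g'_{s_m})\Bigl(\prod_{\tilde s\prec s_m}g'_{\tilde s}\Bigr)\Bigl\{-\ln 2\pi+\psi(a'_{s_m})-\ln b'_{s_m}-\frac{a'_{s_m}}{b'_{s_m}}\bigl(x_t-(\bm x_t^{\mathrm A})^\top\bm\mu'_{s_m}\bigr)^2-(\bm x_t^{\mathrm A})^\top(\bm\Lambda'_{s_m})^{-1}\bm x_t^{\mathrm A}\Bigr\},$$ and $\psi$ denotes the digamma function.
   Context: Trees. Let $M,D_{\max},J,K,n\in\mathbb N$ be positive. $T_{\max}$ is the $M$-ary perfect rooted tree of depth $D_{\max}$ with root $s_\lambda$; $\mathcal I_{\max}$, $\mathcal L_{\max}$ are its sets of inner nodes and leaves, $\mathcal S_{\max}=\mathcal I_{\max}\cup\mathcal L_{\max}$. For $s\in\mathcal I_{\max}$, $s_m$ is its $m$-th child ($1\le m\le M$), and $\mathrm{Ch}(s)$ is its set of children. $s'\preceq s$ means $s'$ is an ancestor of $s$ or $s'=s$; $s'\prec s$ means $s'\preceq s$ and $s'\ne s$. $\mathcal T$ is the set of regular subtrees $T$ of $T_{\max}$ with root $s_\lambda$ (each node of $T$ has either all of its $M$ children in $T$ or none); $\mathcal I_T,\mathcal L_T$ are the inner nodes and leaves of $T$. Context matrices. $\bm U_t=[\bm u_{t,0},\dots,\bm u_{t,D_{\max}-1}]^\top\in\{0,1\}^{D_{\max}\times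 M}$ has one-hot rows; its row for depth $d$ having a 1 in position $m$ means that the path from the root goes from its depth-$d$ node to that node's $m$-th child. $\mathsf s(\bm U_t)\in\mathcal L_{\max}$ is the leaf reached by this path. Model. Data: $\bm x=[x_1,\dots,x_n]^\top\in\mathbb R^n$ together with given initial values $x_{1-\max\{J,K\}},\dots,x_0\in\mathbb R$ (everything is conditional on these). $\bm x_t^{\mathrm L}=[1,x_{t-1},\dots,x_{t-J}]^\top$, $\bm x_t^{\mathrm A}=[1,x_{t-1},\dots,x_{t-K}]^\top$, and $\bm X^{\mathrm A}$ is the $n\times(K+1)$ matrix with $t$-th row $(\bm x_t^{\mathrm A})^\top$. $\bm W=\{\bm W_s\}_{s\in\mathcal I_{\max}}$ with $\bm W_s\in\mathbb R^{M\times(J+1)}$. $\sigma_m(\bm v)=e^{v_m}/\sum_{i=1}^Me^{v_i}$. $I\{\cdot\}$ is the indicator function. The joint density is $$p(\bm x,\bm U,T,\bm\theta,\bm\tau\mid\bm W)=p(T)\,p(\bm\theta,\bm\tau\mid T)\prod_{t=1}^n p(\bm U_t\mid\bm W,\bm x_t^{\mathrm L})\,p(x_t\mid x^{t-1},\bm U_t,\bm\theta,\bm\tau,T),$$ where - $p(\bm U_t\mid\bm W,\bm x_t^{\mathrm L})=\prod_{s\in\mathcal I_{\max}}\prod_{m=1}^M\sigma_m(\bm W_s\bm x_t^{\mathrm L})^{I\{s_m\preceq\mathsf s(\bm U_t)\}}$; - $p(x_t\mid x^{t-1},\bm U_t,\bm\theta,\bm\tau,T)=\prod_{s\in\mathcal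 L_T}\mathcal N(x_t\mid(\bm x_t^{\mathrm A})^\top\bm\theta_s,\tau_s^{-1})^{I\{s\preceq\mathsf s(\bm U_t)\}}$, with $\bm\theta=\{\bm\theta_s\}_{s\in\mathcal L_T}$, $\bm\theta_s\in\mathbb R^{K+1}$, $\bm\tau=\{\tau_s\}_{s\in\mathcal L_T}$, $\tau_s>0$; - $p(T)=\prod_{s\in\mathcal I_T}g_s\prod_{s\in\mathcal L_T}(1-g_s)$, with $g_s\in[0,1]$ and $g_s=0$ for $s\in\mathcal L_{\max}$; - $p(\bm\theta,\bm\tau\mid T)=\prod_{s\in\mathcal L_T}\mathcal N(\bm\theta_s\mid\bm\mu,(\tau_s\bm\Lambda)^{-1})\,\mathrm{Gam}(\tau_s\mid a,b)$, with $\bm\mu\in\mathbb R^{K+1}$, $\bm\Lambda$ symmetric positive definite, $a,b>0$. Here $\mathcal N(\cdot\mid\text{mean},\text{(co)variance})$ is the Gaussian density and $\mathrm{Gam}(\tau\mid a,b)=\frac{b^a}{\Gamma(a)}\tau^{a-1}e^{-b\tau}$. Conventions: $\ln0=-\infty$, and trees $T$ of $q$-probability zero contribute $0$ to expectations under $q$. Current variational distribution of $(T,\bm\theta,\bm\tau)$. Branching probabilities are numbers $\pi^\circ_{t,s,s_m}\ge0$ ($1\le t\le n$, $s\in\mathcal I_{\max}$, $1\le m\le M$) with $\sum_m\pi^\circ_{t,s,s_m}=1$. From them define, for $s\in\mathcal S_{\max}$, $q_{s,t}=\prod_{s',\,s'_{\mathrm{ch}}\preceq s}\pi^\circ_{t,s',s'_{\mathrm{ch}}}$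 (product over all parent–child pairs $(s',s'_{\mathrm{ch}})$ on the path from $s_\lambda$ to $s$; $q_{s_\lambda,t}=1$), $\bm Q_s=\mathrm{diag}\{q_{s,1},\dots,q_{s,n}\}$, and $$\bm\Lambda'_s=\bm\Lambda+(\bm X^{\mathrm A})^\top\bm Q_s\bm X^{\mathrm A},\quad \bm\mu'_s=(\bm\Lambda'_s)^{-1}(\bm\Lambda\bm\mu+(\bm X^{\mathrm A})^\top\bm Q_s\bm x),\quad a'_s=a+\tfrac12\mathrm{Tr}\{\bm Q_s\},$$ $$b'_s=b+\tfrac12\bigl(\bm\mu^\top\bm\Lambda\bm\mu+\bm x^\top\bm Q_s\bm x-(\bm\mu'_s)^\top\bm\Lambda'_s\bm\mu'_s\bigr),$$ $$\ln\gamma_s=\tfrac12\ln|\bm\Lambda|-\tfrac12\ln|\bm\Lambda'_s|+a\ln b-a'_s\ln b'_s-\ln\Gamma(a)+\ln\Gamma(a'_s)-\tfrac12\mathrm{Tr}\{\bm Q_s\}\ln2\pi,$$ $\phi_s=\gamma_s$ for $s\in\mathcal L_{\max}$ and $\phi_s=(1-g_s)\gamma_s+g_s\prod_{s_{\mathrm{ch}}\in\mathrm{Ch}(s)}\phi_{s_{\mathrm{ch}}}$ for $s\in\mathcal I_{\max}$; $g'_s=0$ for $s\in\mathcal L_{\max}$ and $g'_s=g_s\prod_{s_{\mathrm{ch}}\in\mathrm{Ch}(s)}\phi_{s_{\mathrm{ch}}}/\phi_s$ for $s\in\mathcal I_{\max}$. The current variational distribution is $q(T,\bm\theta,\bm\tau)=q(T)\prod_{s\in\mathcal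 L_T}q(\bm\theta_s,\tau_s)$ with $q(T)=\prod_{s\in\mathcal I_T}g'_s\prod_{s\in\mathcal L_T}(1-g'_s)$ and $q(\bm\theta_s,\tau_s)=\mathcal N(\bm\theta_s\mid\bm\mu'_s,(\tau_s\bm\Lambda'_s)^{-1})\,\mathrm{Gam}(\tau_s\mid a'_s,b'_s)$. *)

(* Defs.v *)
From HB Require Import structures.
From mathcomp Require Import all_boot all_order all_algebra.
From mathcomp Require Import all_classical all_reals all_analysis.

Set Implicit Arguments.
Unset Strict Implicit.
Unset Printing Implicit Defensive.

Import Order.TTheory GRing.Theory Num.Theory.
Import numFieldNormedType.Exports.

Local Open Scope ring_scope.

Lemma sigma_finite_product (R : realType) d1 d2 (T1 : measurableType d1)
    (T2 : measurableType d2) (m1 : {sigma_finite_measure set T1 -> \bar R})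
    (m2 : {sigma_finite_measure set T2 -> \bar R}) :
  sigma_finite setT (m1 \x m2)%E.
Proof.
have /sigma_finiteP[F [TF ndF Foo]] := sigma_finiteT m1.
have /sigma_finiteP[G [TG ndG Goo]] := sigma_finiteT m2.
exists (fun n => (F n `*` G n)%classic).
  rewrite -setXTT TF TG predeqE => -[x y]; split.
    move=> [/= [n _ Fnx] [k _ Gky]]; exists (maxn n k) => //; split.
    - by move: x Fnx; exact/subsetPset/ndF/leq_maxl.
    - by move: y Gky; exact/subsetPset/ndG/leq_maxr.
  by move=> [n _ []/= ? ?]; split; exists n.
move=> k; have [? ?] := Foo k; have [? ?] := Goo k.
split; first exact: measurableX.
by rewrite product_measure1E// lte_mul_pinfty// ge0_fin_numE.
Qed.

(* The library does not make m1 \x m2 canonically sigma-finite for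
   sigma-finite m1 and m2. *)
Definition product_sigma_finite (R : realType) d1 d2 (T1 : measurableType d1)
    (T2 : measurableType d2) (m1 : {sigma_finite_measure set T1 -> \bar R})
    (m2 : {sigma_finite_measure set T2 -> \bar R}) :
    {sigma_finite_measure set (T1 * T2)%type -> \bar R} :=
  HB.pack_for {sigma_finite_measure set (T1 * T2)%type -> \bar R}
    (m1 \x m2)%E
    (Measure_isSigmaFinite.Build _ _ _ (m1 \x m2)%E
       (sigma_finite_product m1 m2)).

(* The n-fold product of mu on n.-tuple T, built coordinate by coordinate. *)
Section TupleMeasure.
Context d (T : measurableType d) (R : realType).

Definition tcons (n : nat) (z : T * n.-tuple T) : n.+1.-tuple T :=
  [tuple of z.1 :: z.2].

Fixpoint tuple_measure (mu : set T -> \bar R) (n : nat) :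
    set (n.-tuple T) -> \bar R :=
  match n with
  | 0 => dirac [tuple]
  | n'.+1 => pushforward (mu \x @tuple_measure mu n')%E (@tcons n')
  end.

Variable mu : {sigma_finite_measure set T -> \bar R}.

Lemma measurable_tcons n : measurable_fun setT (@tcons n).
Proof. exact: (measurable_cons measurable_fst measurable_snd). Qed.

Lemma sigma_finite_tcons n (m : {sigma_finite_measure set (T * n.-tuple T)%type -> \bar R}) :
  sigma_finite setT (pushforward m (@tcons n)).
Proof.
have /sigma_finiteP[F [TF ndF Foo]] := sigma_finiteT m.
pose h (y : n.+1.-tuple T) : T * n.-tuple T := (thead y, [tuple of behead y]).
have mh : measurable_fun setT h.
  by apply: measurable_fun_pair; [exact: measurable_tnth|exact: measurable_behead].
have hK z : h (tcons z) = z.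
  by case: z => z1 z2; rewrite /h /tcons theadE; congr pair; apply/val_inj.
exists (fun k => (h @^-1` F k)%classic).
  by rewrite -preimage_bigcup -TF preimage_setT.
move=> k; have [mFk Fk] := Foo k; split.
  by rewrite -[X in measurable X]setTI; exact: mh.
rewrite /pushforward -comp_preimage (_ : h \o @tcons n = id) //.
by apply/funext => z /=; rewrite hK.
Qed.

Lemma tuple_measureP n :
  exists m : {sigma_finite_measure set (n.-tuple T) -> \bar R},
    m = @tuple_measure mu n :> (set (n.-tuple T) -> \bar R).
Proof.
elim: n => [|n [m mE]].
  by exists (dirac ([tuple] : 0.-tuple T)).
pose p := product_sigma_finite mu m.
pose q : {measure set (n.+1.-tuple T) -> \bar R} :=
  @measure_function_pushforward__canonical__measure_function_Measure
    _ _ _ _ _ p _ (@measurable_tcons n).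
pose H := Measure_isSigmaFinite.Build _ _ _ q (@sigma_finite_tcons n p).
pose q' := HB.pack_for {sigma_finite_measure set (n.+1.-tuple T) -> \bar R} (Measure.sort q) H.
by exists q'; rewrite /= -mE.
Qed.

Section TupleMeasureInstance.
Variable n : nat.
Let m := @tuple_measure mu n.

Let m0 : m classical_sets.set0 = 0%E.
Proof. by rewrite /m; have [p <-] := tuple_measureP n; exact: measure0. Qed.

Let m_ge0 A : (0 <= m A)%E.
Proof. by rewrite /m; have [p <-] := tuple_measureP n; exact: measure_ge0. Qed.

Let m_sigma_additive : semi_sigma_additive m.
Proof.
by rewrite /m; have [p <-] := tuple_measureP n;
  exact: measure_semi_sigma_additive.
Qed.

HB.instance Definition _ := isMeasure.Build _ _ _ (@tuple_measure mu n)
  m0 m_ge0 m_sigma_additive.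

Let m_sigma_finite : sigma_finite setT m.
Proof. by rewrite /m; have [p <-] := tuple_measureP n; exact: sigma_finiteT. Qed.

HB.instance Definition _ := Measure_isSigmaFinite.Build _ _ _
  (@tuple_measure mu n) m_sigma_finite.
End TupleMeasureInstance.

End TupleMeasure.

Section Densities.
Variable R : realType.

Definition dot d (u v : 'cV[R]_d) : R := (u^T *m v) 0 0.

Definition quad d (A : 'M[R]_d) (v : 'cV[R]_d) : R := (v^T *m A *m v) 0 0.

Definition sym_posdef d (A : 'M[R]_d) : Prop :=
  A^T = A /\ forall v : 'cV[R]_d, v != 0 -> 0 < quad A v.

Definition Gamma (z : R) : R :=
  \int[lebesgue_measure]_(t in `]0%R, +oo[%classic) (t `^ (z - 1) * expR (- t)).

Definition digamma (z : R) : R := derive1 (fun y : R => ln (Gamma y)) z.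

Definition softmax M (v : 'cV[R]_M) (m : 'I_M) : R :=
  expR (v m 0) / \sum_(i < M) expR (v i 0).

(* Sigma is the covariance matrix. *)
Definition mvnormal_pdf d (m : 'cV[R]_d) (Sigma : 'M[R]_d) (v : 'cV[R]_d) : R :=
  (Num.sqrt ((2 * pi) ^+ d * \det Sigma))^-1
  * expR (- (quad (invmx Sigma) (v - m) / 2)).

Definition gamma_pdf (a b tau : R) : R :=
  b `^ a / Gamma a * tau `^ (a - 1) * expR (- (b * tau)).

End Densities.

(* A node is the sequence of child indices on the path from the root, so that
   s' is an ancestor of s or s itself iff s' is a prefix of s. *)
Section Trees.
Variables M D : nat.

Definition node := D.-bseq 'I_M.

Definition root : node := [bseq].

Definition inner (s : node) : bool := (size s < D)%N.

(* Meaningful only when s is inner. *)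
Definition child (s : node) (m : 'I_M) : node := insub_bseq D (rcons s m).

Definition anc (s' s : node) : bool := prefix s' s.

Definition sanc (s' s : node) : bool := anc s' s && (s' != s).

Definition regular_subtree (T : {set node}) : bool :=
  [&& root \in T,
      [forall s in T, forall s' : node, anc s' s ==> (s' \in T)] &
      [forall s in T, inner s ==>
         ([forall m, child s m \in T] || [forall m, child s m \notin T])]].

Definition inner_nodes (T : {set node}) : {set node} :=
  [set s in T | inner s && [exists m, child s m \in T]].

Definition leaves (T : {set node}) : {set node} := T :\: inner_nodes T.

Definition one_hot_rows (U : 'M[bool]_(D, M)) : bool :=
  [forall d, #|[set m | U d m]| == 1%N].

Definition ctx := {U : 'M[bool]_(D, M) | one_hot_rows U}.

Definition ctx_leaf (U : ctx) : node :=
  insub_bseq D (pmap (fun d : 'I_D => [pick m | val U d m]) (enum 'I_D)).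

Lemma size_child (s : node) m : inner s -> size (child s m) = (size s).+1.
Proof.
by rewrite /inner => sD; rewrite /child val_insubd size_rcons sD size_rcons.
Qed.

Lemma size_ctx_leaf (U : ctx) : size (ctx_leaf U) = D.
Proof.
have pickU d : exists m, [pick m | val U d m] = Some m.
  have /forallP/(_ d) := valP U; case: pickP => [m _ _|U0]; first by exists m.
  by rewrite (_ : [set _ | _] = finset.set0) ?cards0//; apply/setP => m; rewrite !inE U0.
have szE : size (pmap (fun d : 'I_D => [pick m | val U d m]) (enum 'I_D)) = D.
  rewrite size_pmap -[RHS](size_enum_ord D) -[RHS]count_predT.
  by apply: eq_count => d /=; have [m ->] := pickU d.
by rewrite /ctx_leaf val_insubd szE leqnn.
Qed.

End Trees.

(* Times 1, ..., n are represented by 'I_n, and x0 lists the initial values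
   x_(1 - max(J, K)), ..., x_0 in this order. *)
Record softBCT (R : realType) (M D J K n : nat) := SoftBCT {
  x : 'cV[R]_n;
  x0 : 'cV[R]_(maxn J K);
  W : node M D -> 'M[R]_(M, J.+1);
  g : node M D -> R;
  mu : 'cV[R]_K.+1;
  Lambda : 'M[R]_K.+1;
  a : R;
  b : R;
  g_itv : forall s, 0 <= g s <= 1;
  g_leaf : forall s, ~~ inner s -> g s = 0;
  Lambda_sym_posdef : sym_posdef Lambda;
  a_gt0 : 0 < a;
  b_gt0 : 0 < b }.

Section Model.
Variables (R : realType) (M D J K n : nat) (B : softBCT R M D J K n).
Local Notation node := (node M D).
Local Notation ctx := (ctx M D).
Local Notation root := (root M D).

(* lag t j is x_(t - j), for j <= max(J, K). *)
Definition lag (t : 'I_n) (j : nat) : R :=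
  nth 0 ([seq x0 B i 0 | i <- enum 'I_(maxn J K)] ++
         [seq x B i 0 | i <- enum 'I_n]) (maxn J K + t - j).

Definition lagvec (p : nat) (t : 'I_n) : 'cV[R]_p.+1 :=
  \col_i (if i == 0 then 1 else lag t i).

Definition xL (t : 'I_n) : 'cV[R]_J.+1 := lagvec J t.
Definition xA (t : 'I_n) : 'cV[R]_K.+1 := lagvec K t.
Definition XA : 'M[R]_(n, K.+1) := \matrix_(t, k) xA t k 0.

Definition ctx_pmf (t : 'I_n) (U : ctx) : R :=
  \prod_(s : node | inner s) \prod_(m < M)
    softmax (W B s *m xL t) m ^+ (anc (child s m) (ctx_leaf U)).

Definition obs_pdf (t : 'I_n) (U : ctx) (T : {set node})
    (theta : node -> 'cV[R]_K.+1) (tau : node -> R) : R :=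
  \prod_(s in leaves T)
    normal_pdf (dot (xA t) (theta s)) (Num.sqrt (tau s)^-1) (x B t 0)
      ^+ (anc s (ctx_leaf U)).

Definition tree_pmf (h : node -> R) (T : {set node}) : R :=
  (\prod_(s in inner_nodes T) h s) * \prod_(s in leaves T) (1 - h s).

Definition normal_gamma_pdf (m : 'cV[R]_K.+1) (L : 'M[R]_K.+1) (c d : R)
    (theta : 'cV[R]_K.+1) (tau : R) : R :=
  mvnormal_pdf m (invmx (tau *: L)) theta * gamma_pdf c d tau.

Definition param_pdf (T : {set node})
    (theta : node -> 'cV[R]_K.+1) (tau : node -> R) : R :=
  \prod_(s in leaves T)
    normal_gamma_pdf (mu B) (Lambda B) (a B) (b B) (theta s) (tau s).

Definition joint_pdf (U : {ffun 'I_n -> ctx}) (T : {set node})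
    (theta : node -> 'cV[R]_K.+1) (tau : node -> R) : R :=
  tree_pmf (g B) T * param_pdf T theta tau *
  \prod_(t < n) (ctx_pmf t (U t) * obs_pdf t (U t) T theta tau).

(* piv t s m is the current branching probability from s to its m-th child. *)
Variable piv : 'I_n -> node -> 'I_M -> R.

Definition reach (s : node) (t : 'I_n) : R :=
  \prod_(s' : node | inner s') \prod_(m | anc (child s' m) s) piv t s' m.

Definition Q (s : node) : 'M[R]_n := diag_mx (\row_t reach s t).

Definition Lambda' (s : node) : 'M[R]_K.+1 := Lambda B + XA^T *m Q s *m XA.

Definition mu' (s : node) : 'cV[R]_K.+1 :=
  invmx (Lambda' s) *m (Lambda B *m mu B + XA^T *m Q s *m x B).

Definition a' (s : node) : R := a B + \tr (Q s) / 2.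

Definition b' (s : node) : R :=
  b B + (quad (Lambda B) (mu B) + quad (Q s) (x B)
         - quad (Lambda' s) (mu' s)) / 2.

Definition ln_gamma (s : node) : R :=
  ln (\det (Lambda B)) / 2 - ln (\det (Lambda' s)) / 2
  + a B * ln (b B) - a' s * ln (b' s)
  - ln (Gamma (a B)) + ln (Gamma (a' s))
  - \tr (Q s) / 2 * ln (2 * pi).

Definition gamma (s : node) : R := expR (ln_gamma s).

(* k is the height of s. *)
Fixpoint phi_rec (k : nat) (s : node) : R :=
  match k with
  | 0 => gamma s
  | k'.+1 => (1 - g B s) * gamma s
             + g B s * \prod_(m < M) phi_rec k' (child s m)
  end.

Definition phi (s : node) : R := phi_rec (D - size s) s.

Lemma phi_leaf s : ~~ inner s -> phi s = gamma s.
Proof. by rewrite /inner -leqNgt /phi -subn_eq0 => /eqP->. Qed.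

Lemma phi_inner s : inner s ->
  phi s = (1 - g B s) * gamma s + g B s * \prod_(m < M) phi (child s m).
Proof.
move=> sD; rewrite /phi -[(D - size s)%N]prednK ?subn_gt0//=.
congr (_ + _ * _); apply: eq_bigr => m _.
by rewrite (size_child _ sD) subnS.
Qed.

Definition g' (s : node) : R :=
  if inner s then g B s * (\prod_(m < M) phi (child s m)) / phi s else 0.

Definition qparam_pdf (T : {set node})
    (theta : node -> 'cV[R]_K.+1) (tau : node -> R) : R :=
  \prod_(s in leaves T)
    normal_gamma_pdf (mu' s) (Lambda' s) (a' s) (b' s) (theta s) (tau s).

(* For a given tree T, (theta, tau) ranges over (R^(K+1) * R)^(leaves T), the
   leaves being listed by enum; the Lebesgue measure is used on this space. *)
Definition leaf_param : Type :=
  (K.+1.-tuple (measurableTypeR R) * measurableTypeR R)%type.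

Definition leaf_lebesgue :=
  product_sigma_finite
    (@tuple_measure _ _ _ (@lebesgue_measure R) K.+1) (@lebesgue_measure R).

Definition leaf_coord (T : {set node}) (z : #|leaves T|.-tuple leaf_param)
    (s : node) : leaf_param :=
  nth ([tuple of nseq K.+1 0], 0) z (index s (enum (leaves T))).

Definition theta_of (T : {set node}) (z : #|leaves T|.-tuple leaf_param)
    (s : node) : 'cV[R]_K.+1 := \col_k tnth (leaf_coord z s).1 k.

Definition tau_of (T : {set node}) (z : #|leaves T|.-tuple leaf_param)
    (s : node) : R := (leaf_coord z s).2.

(* In \bar R, 0 * e = 0 for every e: trees T with tree_pmf g' T = 0 contribute 0. *)
Definition expect_q
    (f : {set node} -> (node -> 'cV[R]_K.+1) -> (node -> R) -> \bar R) : \bar R :=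
  (\sum_(T : {set node} | regular_subtree T)
    (tree_pmf g' T)%:E *
    \int[@tuple_measure _ _ _ leaf_lebesgue #|leaves T|]_(z in
        [set z | forall s, s \in leaves T -> (0 < tau_of z s)%R]%classic)
      ((qparam_pdf T (theta_of z) (tau_of z))%:E
       * f T (theta_of z) (tau_of z)))%E.

Definition is_pmf (I : finType) (q : I -> R) : Prop :=
  (forall i, 0 <= q i) /\ \sum_i q i = 1.

Definition is_optimal_qU (q : {ffun {ffun 'I_n -> ctx} -> R}) : Prop :=
  is_pmf q /\
  exists c : R, forall U : {ffun 'I_n -> ctx},
    lne (q U)%:E
    = (expect_q (fun T theta tau => lne (joint_pdf U T theta tau)%:E) + c%:E)%E.

Definition marginal (q : {ffun {ffun 'I_n -> ctx} -> R}) (t : 'I_n) (u : ctx) : R :=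
  \sum_(U : {ffun 'I_n -> ctx} | U t == u) q U.

Definition star (t : 'I_n) (s : node) : R :=
  (1 - g' s) / 2 * (\prod_(s' | sanc s' s) g' s') *
  (- ln (2 * pi) + digamma (a' s) - ln (b' s)
   - a' s / b' s * (x B t 0 - dot (xA t) (mu' s)) ^+ 2
   - quad (invmx (Lambda' s)) (xA t)).

(* k is the height of the m-th child of s. *)
Fixpoint rho_rec (k : nat) (t : 'I_n) (s : node) (m : 'I_M) : R :=
  expR (ln (softmax (W B s *m xL t) m) + star t (child s m) +
    match k with
    | 0 => 0
    | k'.+1 => ln (\sum_(m' < M) rho_rec k' t (child s m) m')
    end).

Definition rho (t : 'I_n) (s : node) (m : 'I_M) : R :=
  rho_rec (D - (size s).+1) t s m.

Lemma rho_gt0 t s m : 0 < rho t s m.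
Proof. by rewrite /rho; case: (D - _)%N => [|k]; exact: expR_gt0. Qed.

Lemma ln_rho_inner t s m : inner s -> inner (child s m) ->
  ln (rho t s m) = ln (softmax (W B s *m xL t) m) + star t (child s m)
                   + ln (\sum_(m' < M) rho t (child s m) m').
Proof.
move=> sD; rewrite /rho /inner !(size_child _ sD) => cD.
rewrite -[(D - (size s).+1)%N]prednK ?subn_gt0//= expRK.
by rewrite -!subnS.
Qed.

Lemma ln_rho_leaf t s m : inner s -> ~~ inner (child s m) ->
  ln (rho t s m) = ln (softmax (W B s *m xL t) m) + star t (child s m).
Proof.
move=> sD; rewrite /rho /inner !(size_child _ sD) -leqNgt -subn_eq0 => /eqP->.
by rewrite /= expRK addr0.
Qed.

Definition pi' (t : 'I_n) (s : node) (m : 'I_M) : R :=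
  rho t s m / \sum_(m' < M) rho t s m'.

End Model.

(* Main.v *)
(* Given a tree T, the logarithm of the joint density is a constant plus a sum,
   over the leaves s of T, of functions of (theta_s, tau_s) alone; under the
   product density q(theta, tau | T) its integral is therefore a sum of
   one-leaf normal-gamma moments.  These only involve E[ln tau],
   E[tau (y - h^T theta)^2] and similar quadratic terms: the former comes from
   differentiating Gamma under the integral sign, the latter from integrating
   out one coordinate of theta at a time and passing to the Schur complement of
   the precision matrix.

   q(T) is the law of the tree grown from the root by independent branching
   decisions with probabilities g'_s, so a node s is a leaf of T with
   probability (1 - g'_s) prod_(s' < s) g'_s'.  Hence the expected log-density
   is, up to a constant, the sum over t of ln p(U_t) plus the star terms
   collected on the path of U_t.  Exponentiating gives a product over t of path
   weights, and rho normalizes them by summing over subtrees from the leaves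
   upward: along each path the normalizers telescope, leaving only the one at
   the root. *)
Require Import Defs.
From HB Require Import structures.
From mathcomp Require Import all_boot all_order all_algebra.
From mathcomp Require Import all_classical all_reals all_analysis.
From mathcomp Require Import measurable_realfun ring lra.

Set Implicit Arguments.
Unset Strict Implicit.
Unset Printing Implicit Defensive.

Import Order.TTheory GRing.Theory Num.Theory.
Import numFieldNormedType.Exports.

Local Open Scope ring_scope.

(** * Integrals of real-valued functions *)

(** Three obstacles shape the argument. Integrals take extended real values and are additive only on
    integrable functions, so every moment is carried as integrability together with a real value;
    the one-leaf densities are extended by zero, so that the constraint tau > 0 disappears from the
    domain. The logarithm of a vanishing prior is [-oo]; but where g_s is 0 or 1, g'_s takes the
    same value, so such trees also have weight 0 under q. Finally, the additive constant must be the
    same for all U: the expected log-prior of a leaf is never computed, only shown to exist before U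
    is chosen. Every nontrivial univariate moment comes from one principle: if f exp(s S) integrates
    to Z(s) for small s, then f S integrates to Z'(0). For the statistics S = -t, ln t, v and -v^2/2
    the tilted function stays in the gamma or Gaussian family, so Z is explicit. The random tree is
    read off a vector of independent Boolean decisions at all nodes, reached or not; trees and leaf
    events then become cylinder sets. *)

Section HasIntegral.
Context d (T : measurableType d) (R : realType) (m : {measure set T -> \bar R}).
Implicit Types (f g : T -> R) (u v r : R).

Definition has_integral f v : Prop :=
  m.-integrable [set: T] (EFin \o f) /\ (\int[m]_x (f x)%:E = v%:E)%E.

Lemma has_integral_measurable f v : has_integral f v -> measurable_fun setT f.
Proof. by move=> [/integrableP[/measurable_EFinP]]. Qed.

Lemma has_integral_ext f g v : f =1 g -> has_integral f v -> has_integral g v.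
Proof. by move=> /funext->. Qed.

Lemma has_integral0 : has_integral (fun=> 0) 0.
Proof. by split; [exact: integrable0 | rewrite integral0]. Qed.

Lemma has_integralZ r f v : has_integral f v ->
  has_integral (fun x => r * f x) (r * v).
Proof.
move=> [fi fv]; split.
  rewrite (_ : _ \o _ = (fun x => r%:E * (EFin \o f) x)%E); last first.
    by apply/funext => x /=; rewrite EFinM.
  exact: integrableZl.
under eq_integral do rewrite EFinM.
by rewrite integralZl// fv.
Qed.

Lemma has_integralD f g u v : has_integral f u -> has_integral g v ->
  has_integral (fun x => f x + g x) (u + v).
Proof.
move=> [fi fu] [gi gv]; split.
  rewrite (_ : _ \o _ = (EFin \o f) \+ (EFin \o g))%E; last first.
    by apply/funext => x /=; rewrite EFinD.
  exact: integrableD.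
under eq_integral do rewrite EFinD.
by rewrite integralD// fu gv.
Qed.

Lemma has_integralB f g u v : has_integral f u -> has_integral g v ->
  has_integral (fun x => f x - g x) (u - v).
Proof.
move=> hf /(has_integralZ (-1)) hg.
have := has_integralD hf hg; rewrite mulN1r; apply: has_integral_ext => x.
by rewrite mulN1r.
Qed.

Lemma has_integral_sum (I : Type) (s : seq I) (P : pred I) (f : I -> T -> R)
    (v : I -> R) : (forall i, P i -> has_integral (f i) (v i)) ->
  has_integral (fun x => \sum_(i <- s | P i) f i x) (\sum_(i <- s | P i) v i).
Proof.
move=> H; elim: s => [|i s IH].
  by rewrite big_nil; apply: has_integral_ext has_integral0 => x; rewrite big_nil.
rewrite big_cons; case: ifPn => Pi; last first.
  by apply: has_integral_ext IH => x; rewrite big_cons (negbTE Pi).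
apply: has_integral_ext (has_integralD (H _ Pi) IH) => x.
by rewrite big_cons Pi.
Qed.

Lemma ge0_has_integral f v : measurable_fun setT f -> (forall x, 0 <= f x) ->
  (\int[m]_x (f x)%:E = v%:E)%E -> has_integral f v.
Proof.
move=> mf f0 fv; split => //; apply/integrableP; split; first exact/measurable_EFinP.
by under eq_integral do rewrite /= ger0_norm//; rewrite fv ltry.
Qed.

Lemma has_integral_abs f v : has_integral f v ->
  exists u, has_integral (fun x => `|f x|) u.
Proof.
move=> [fi _]; have ai : m.-integrable setT (EFin \o (fun x => `|f x|)).
  exact: integrable_norm.
exists (fine (\int[m]_x (`|f x|)%:E)); split => //.
by rewrite fineK//; exact: integrable_fin_num.
Qed.

Lemma integrable_has_integral f : m.-integrable [set: T] (EFin \o f) ->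
  exists v, has_integral f v.
Proof.
move=> fi; exists (fine (\int[m]_x (f x)%:E)); split => //.
by rewrite fineK//; exact: integrable_fin_num.
Qed.

Lemma le_has_integral f g u : measurable_fun setT f ->
  (forall x, `|f x| <= g x) -> has_integral g u -> exists v, has_integral f v.
Proof.
move=> mf fg [gi gu]; apply: integrable_has_integral.
apply: le_integrable gi => //; first exact/measurable_EFinP.
move=> x _ /=; rewrite lee_fin; exact: (le_trans (fg x) (ler_norm _)).
Qed.

End HasIntegral.

(** * Integration over a product of two spaces *)

Section Fubini.
Context d1 d2 (T1 : measurableType d1) (T2 : measurableType d2) (R : realType).
Variables (m1 : {sigma_finite_measure set T1 -> \bar R})
          (m2 : {sigma_finite_measure set T2 -> \bar R}).

(** The iterated integral of [|f|] is the finite [u], so Tonelli makes [f] integrable on the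
    product; only then does Fubini give the value. Integrating the first coordinate first suits both
    [tcons] (head before tail) and a leaf ([theta] before [tau]). *)
Lemma has_integral_fubini (f : T1 * T2 -> R) (g h : T2 -> R) (u v : R) :
  measurable_fun setT f ->
  (forall y, has_integral m1 (fun x => `|f (x, y)|) (h y)) ->
  (forall y, has_integral m1 (fun x => f (x, y)) (g y)) ->
  has_integral m2 h u -> has_integral m2 g v ->
  has_integral (m1 \x m2)%E f v.
Proof.
move=> mf fh fg [_ hu] [_ gv].
have mf' : measurable_fun setT (EFin \o f) by exact/measurable_EFinP.
have fi : (m1 \x m2)%E.-integrable setT (EFin \o f).
  apply/(integrable21ltyP m1 m2 mf').
  under eq_integral.
    move=> y _.
    under eq_integral do rewrite /=.
    rewrite (fh y).2.
    over.
  by rewrite hu ltry.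
split => //.
rewrite -(integral21_prod_meas1 fi) -gv.
by apply: eq_integral => y _; rewrite /fubini_G/= (fg y).2.
Qed.

Lemma ge0_has_integral_fubini (f : T1 * T2 -> R) (g : T2 -> R) (v : R) :
  measurable_fun setT f -> (forall z, 0 <= f z) ->
  (forall y, has_integral m1 (fun x => f (x, y)) (g y)) ->
  has_integral m2 g v -> has_integral (m1 \x m2)%E f v.
Proof.
move=> mf f0 fg gv; apply: (has_integral_fubini mf _ fg gv gv) => y.
by apply: has_integral_ext (fg y) => x; rewrite ger0_norm.
Qed.

Lemma has_integral_prod (f : T1 -> R) (g : T2 -> R) (u v : R) :
  has_integral m1 f u -> has_integral m2 g v ->
  has_integral (m1 \x m2)%E (fun z => f z.1 * g z.2) (u * v).
Proof.
move=> fu gv; have [u' fu'] := has_integral_abs fu.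
have [v' gv'] := has_integral_abs gv.
have mfg : measurable_fun setT (fun z : T1 * T2 => f z.1 * g z.2).
  apply: measurable_funM; apply: measurableT_comp => //.
  - exact: has_integral_measurable fu.
  - exact: has_integral_measurable gv.
apply: (has_integral_fubini mfg _ _ (has_integralZ u' gv') (has_integralZ u gv)) => y /=.
- rewrite mulrC; apply: has_integral_ext (has_integralZ `|g y| fu') => x.
  by rewrite normrM mulrC.
- rewrite mulrC; apply: has_integral_ext (has_integralZ (g y) fu) => x.
  by rewrite mulrC.
Qed.

End Fubini.

(** * Finite products of densities *)

Section TupleIntegral.
Context d (T : measurableType d) (R : realType).
Variable mu : {sigma_finite_measure set T -> \bar R}.

Lemma has_integral_tcons n (f : n.+1.-tuple T -> R) (v : R) :
  measurable_fun setT f ->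
  has_integral (mu \x @tuple_measure _ _ _ mu n)%E (f \o @tcons _ _ n) v ->
  has_integral (@tuple_measure _ _ _ mu n.+1) f v.
Proof.
move=> mf [fi fv]; have mf' : measurable_fun setT (EFin \o f).
  exact/measurable_EFinP.
split.
  exact: (integrable_pushforward (@measurable_tcons _ T n) mf' fi).
have := integral_pushforward (@measurable_tcons _ T n) mf' fi measurableT.
by rewrite -fv => <-.
Qed.

Lemma has_integral_tuple0 (f : 0.-tuple T -> R) :
  has_integral (@tuple_measure _ _ _ mu 0) f (f [tuple]).
Proof.
have mf : measurable_fun setT f.
  rewrite (_ : f = cst (f [tuple])) //; apply/funext => z /=.
  by congr f; apply/val_inj; case: z => -[].
have E (g : 0.-tuple T -> \bar R) : measurable_fun setT g ->
    (\int[@tuple_measure _ _ _ mu 0]_z g z = g [tuple])%E.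
  move=> mg; rewrite [LHS](_ : _ = \int[dirac [tuple]]_z g z)%E//.
  by rewrite integral_dirac// diracT mul1e.
split; last by rewrite E//; exact/measurable_EFinP.
apply/integrableP; split; first exact/measurable_EFinP.
rewrite E ?ltry//; apply/measurable_EFinP; exact: measurableT_comp.
Qed.

Lemma tnth_tcons0 n (z : T * n.-tuple T) : tnth (tcons z) ord0 = z.1.
Proof. by []. Qed.

Lemma tnth_tconsS n (z : T * n.-tuple T) i :
  tnth (tcons z) (lift ord0 i) = tnth z.2 i.
Proof. by rewrite tnthS; congr tnth; exact/val_inj. Qed.

Lemma measurable_tnth_comp n (p : 'I_n -> T -> R) i : measurable_fun setT (p i) ->
  measurable_fun setT (fun z : n.-tuple T => p i (tnth z i)).
Proof. by move=> mp; apply: (measurableT_comp mp); exact: measurable_tnth. Qed.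

(** Peeling off the head gives head expectation times tail mass plus head mass times tail
    expectation, so the mass statement has to travel through the same induction. *)
Lemma has_integral_tuple n (p f : 'I_n -> T -> R) (v : 'I_n -> R) :
  (forall i, has_integral mu (p i) 1) ->
  (forall i, measurable_fun setT (f i)) ->
  (forall i, has_integral mu (fun x => p i x * f i x) (v i)) ->
  has_integral (@tuple_measure _ _ _ mu n)
    (fun z => (\prod_i p i (tnth z i)) * \sum_i f i (tnth z i)) (\sum_i v i)
  /\ has_integral (@tuple_measure _ _ _ mu n) (fun z => \prod_i p i (tnth z i)) 1.
Proof.
elim: n p f v => [|n IH] p f v p1 mf pf.
  split.
    rewrite big_ord0.
    have := has_integral_tuple0 (fun z : 0.-tuple T =>
      (\prod_i p i (tnth z i)) * \sum_i f i (tnth z i)).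
    by rewrite !big_ord0 mulr0.
  have := has_integral_tuple0 (fun z : 0.-tuple T => \prod_i p i (tnth z i)).
  by rewrite !big_ord0.
have mp i : measurable_fun setT (p i) := has_integral_measurable (p1 i).
have [IHf IH1] := IH (fun i => p (lift ord0 i)) (fun i => f (lift ord0 i))
  (fun i => v (lift ord0 i)) (fun i => p1 _) (fun i => mf _) (fun i => pf _).
have mprod : measurable_fun setT (fun z : n.+1.-tuple T => \prod_i p i (tnth z i)).
  by apply: measurable_prod => i _; exact: measurable_tnth_comp.
have msum : measurable_fun setT (fun z : n.+1.-tuple T => \sum_i f i (tnth z i)).
  by apply: measurable_sum => i; exact: measurable_tnth_comp.
split; apply: has_integral_tcons => //.
- exact: measurable_funM.
- have := has_integralD (has_integral_prod (pf ord0) IH1)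
    (has_integral_prod (p1 ord0) IHf).
  rewrite mulr1 mul1r big_ord_recl; apply: has_integral_ext => z /=.
  rewrite [X in _ = X * _]big_ord_recl [X in _ = _ * X]big_ord_recl.
  rewrite !tnth_tcons0.
  under [X in _ = _ * X * _]eq_bigr do rewrite tnth_tconsS.
  under [X in _ = _ * (_ + X)]eq_bigr do rewrite tnth_tconsS.
  ring.
- have := has_integral_prod (p1 ord0) IH1.
  rewrite mulr1; apply: has_integral_ext => z /=.
  rewrite [RHS]big_ord_recl tnth_tcons0; congr (_ * _).
  by apply: eq_bigr => i _; rewrite tnth_tconsS.
Qed.

End TupleIntegral.

(** * The Gamma function and univariate Gaussian integrals *)

Section ExponentialFamily.
Context d (T : measurableType d) (R : realType) (m : {measure set T -> \bar R}).

(** From [1 + x <= expR x]: it trades the linear factor created by differentiation for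
    exponentials. *)
Lemma norm_le_expR2 (e r : R) : 0 < e -> `|r| <= e^-1 * (expR (e * r) + expR (- (e * r))).
Proof.
move=> e0; rewrite -(ler_pM2l e0) mulrA divff ?gt_eqF// mul1r.
rewrite -{1}(gtr0_norm e0) -normrM.
have [er|er] := leP 0 (e * r).
  rewrite ger0_norm//; apply: (@le_trans _ _ (expR (e * r))); last by rewrite lerDl expR_ge0.
  by apply: le_trans (expR_ge1Dx _); rewrite lerDr.
rewrite ltr0_norm//.
apply: (@le_trans _ _ (expR (- (e * r)))); last by rewrite lerDr expR_ge0.
by apply: le_trans (expR_ge1Dx _); rewrite lerDr.
Qed.

Lemma expR_norm_le (e s r : R) : `|s| <= e ->
  expR (s * r) <= expR (e * r) + expR (- (e * r)).
Proof.
move=> se; case: (leP 0 r) => r0.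
  apply: (@le_trans _ _ (expR (e * r))); last by rewrite lerDl expR_ge0.
  by rewrite ler_expR ler_wpM2r// (le_trans (ler_norm _) se).
apply: (@le_trans _ _ (expR (- (e * r)))); last by rewrite lerDr expR_ge0.
rewrite ler_expR -mulNr; apply: ler_wnM2r; first exact: ltW.
by rewrite lerNl (le_trans _ se)// -normrN ler_norm.
Qed.

(** Differentiation under the integral sign: [Z] is the normalising constant of the tilt of [f] by
    the statistic [S], and its derivative at 0 is the first moment of [S]. Differentiability of [Z]
    is part of the conclusion, which is how Gamma is later shown to be differentiable. *)
Lemma has_integral_expfam (f S : T -> R) (Z : R -> R) (e : R) :
  0 < e -> measurable_fun setT f -> measurable_fun setT S -> (forall x, 0 <= f x) ->
  (forall s, `|s| < e -> has_integral m (fun x => f x * expR (s * S x)) (Z s)) ->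
  exists2 z, is_derive (0 : R) (1 : R) Z z & has_integral m (fun x => f x * S x) z.
Proof.
move=> e0 mf mS f0 fZ.
(* The dominating function uses the parameters [h + h] and [- (h + h)], which must stay strictly
   within [e]. *)
pose h := e / 4.
have h0 : 0 < h by rewrite divr_gt0.
pose F (s : R) (x : T) := f x * expR (s * S x).
(* This is [h^-1 * f x * (E + E^-1) ^+ 2] with [E = expR (h * S x)], expanded: one factor of the
   square bounds [S x], the other bounds the tilt uniformly in [s]. *)
pose G x := h^-1 * (F (h + h) x + F (- (h + h)) x + 2 * F 0 x).
have hhe : `|h + h| < e by rewrite gtr0_norm ?addr_gt0// /h; lra.
have Gi : m.-integrable setT (EFin \o G).
  have := has_integralD (fZ _ hhe) (fZ (- (h + h)) _).
  rewrite normrN => /(_ hhe) H.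
  have H0 : `|0 : R| < e by rewrite normr0.
  exact: (has_integralZ h^-1 (has_integralD H (has_integralZ 2 (fZ _ H0)))).1.
have dF s x : is_derive s (1 : R) (F ^~ x) (f x * (S x * expR (s * S x))).
  have dl : is_derive s (1 : R) (fun s => s * S x) (S x).
    by apply: is_derive_eq; rewrite scaler0 add0r; exact: mulr1.
  have de : is_derive s (1 : R) (expR \o (fun s => s * S x)) (S x * expR (s * S x)).
    have := @is_derive1_comp _ expR (fun s => s * S x) s _ _ (is_derive_expR _) dl.
    by rewrite mulrC.
  exact: is_deriveZ.
have I0 : (`]-h, h[%classic : set R) 0 by rewrite /= in_itv/= oppr_lt0 h0.
have iF s : (`]-h, h[%classic : set R) s -> m.-integrable setT (EFin \o F s).
  rewrite /= in_itv/= -ltr_norml => sh; apply: (fZ s _).1.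
  by rewrite (lt_trans sh)// /h; lra.
have dF1 s x : (`]-h, h[%classic : set R) s -> setT x -> derivable (F ^~ x) s 1.
  by move=> _ _; have := dF s x.
have dFE s x : partial1of2 F s x = f x * (S x * expR (s * S x)).
  by rewrite partial1of2E; have := dF s x => dFs; rewrite derive_val.
have G0 x : 0 <= G x.
  have F0 s : 0 <= F s x by rewrite mulr_ge0// expR_ge0.
  apply: mulr_ge0; first by rewrite invr_ge0 ltW.
  by apply: addr_ge0; [apply: addr_ge0|apply: mulr_ge0].
have FG s x : (`]-h, h[%classic : set R) s -> setT x -> `|partial1of2 F s x| <= G x.
  rewrite /= in_itv/= -ltr_norml => sh _; rewrite dFE /G /F.
  rewrite normrM ger0_norm// normrM (ger0_norm (expR_ge0 _)).
  rewrite mul0r expR0 mulr1 (_ : _ + _ = f x * (expR ((h + h) * S x)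
    + expR (- (h + h) * S x) + 2)); last by ring.
  rewrite [leRHS]mulrCA ler_wpM2l//.
  apply: (le_trans (ler_pM _ _ (norm_le_expR2 _ h0) (expR_norm_le _ (ltW sh)))) => //.
  rewrite -mulrA; apply: ler_wpM2l; first by rewrite invr_ge0 ltW.
  rewrite mulNr !mulrDl opprD !expRD.
  set E1 := expR _; set E2 := expR _.
  have E12 : E1 * E2 = 1 by rewrite /E1 /E2 -expRD subrr expR0.
  rewrite le_eqVlt; apply/orP; left; apply/eqP.
  have -> : 2 = 2 * (E1 * E2) by rewrite E12 mulr1.
  by ring.
have dZ := derivable_under_integral measurableT I0 iF dF1 G0 Gi FG.
have dZE := differentiation_under_integral measurableT I0 iF dF1 G0 Gi FG.
set z := (X in _ = X) in dZE.
have ne : \forall s \near (0 : R), `|s| < e.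
  exact: (@nbhs0_lt _ R^o).
exists z.
  apply: (@near_eq_is_derive _ _ _ (fun s => \int[m]_(x in setT) F s x)).
    near=> s; have se : `|s| < e by near: s.
    by rewrite /Rintegral (fZ s se).2.
  apply: DeriveDef; first exact: dZ.
  by rewrite -derive1E dZE.
have H0 : has_integral m (fun x => f x * S x) z.
  have zE : z = \int[m]_(x in setT) (f x * S x).
    apply: eq_Rintegral => x _.
    by rewrite /= dFE mul0r expR0 mulr1.
  have gi : m.-integrable setT (EFin \o (fun x => f x * S x)).
    apply: le_integrable Gi => //.
      by apply/measurable_EFinP; exact: measurable_funM.
    move=> x _ /=; rewrite lee_fin (ger0_norm (G0 x)).
    by have := FG 0 x I0 I; rewrite dFE mul0r expR0 mulr1.
  split => //; rewrite zE /Rintegral fineK//.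
  exact: integrable_fin_num.
exact: H0.
Unshelve. all: by end_near. Qed.
End ExponentialFamily.

Section Lebesgue.
Variable R : realType.
Local Notation leb := (@lebesgue_measure R).
Implicit Types (f : R -> R) (r s t v : R).

(** The scaling identity [phiE] compares two measures that agree on half-open intervals, so
    uniqueness of Lebesgue measure gives it for all measurable sets. *)
Lemma ge0_has_integral_affine f v r s : 0 < r -> (forall x, 0 <= f x) ->
  has_integral leb f v -> has_integral leb (fun x => f (r * x + s)) (v / r).
Proof.
move=> r0 f0 fv; have mf := has_integral_measurable fv.
pose phi : measurableTypeR R -> measurableTypeR R := fun x => r * x + s.
have mphi : measurable_fun setT phi.
  by apply: measurable_funD => //; exact: measurable_funM.
have phiE (A : set (measurableTypeR R)) : measurable A ->
    leb A = (r%:E * leb (phi @^-1` A)%classic)%E.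
  pose nu : {measure set (measurableTypeR R) -> \bar R} :=
    @measure_function_pushforward__canonical__measure_function_Measure
      _ _ _ _ _ leb _ mphi.
  pose nu' : {measure set (measurableTypeR R) -> \bar R} :=
    mscale (NngNum (ltW r0)) nu.
  apply: (@lebesgue_measure_unique R nu') => X [[a b] _ <-].
  transitivity (r%:E * leb (phi @^-1` `]a, b])%classic)%E; last by [].
  rewrite (_ : (phi @^-1` _)%classic = `](a - s) / r, (b - s) / r]%classic); last first.
    apply/seteqP; split => x /=; rewrite !in_itv/= /phi.
      by rewrite ltr_pdivrMr// ler_pdivlMr// ltrBlDr lerBrDr mulrC.
    by rewrite ltr_pdivrMr// ler_pdivlMr// ltrBlDr lerBrDr mulrC.
  rewrite !lebesgue_measure_itv/= !lte_fin ltr_pM2r ?invr_gt0// ltrD2r.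
  case: ifPn => _; last by rewrite mule0.
  by rewrite -!EFinD -EFinM; congr EFin; field; rewrite gt_eqF.
apply: ge0_has_integral => //.
  exact: (measurableT_comp mf mphi).
have := @ge0_integral_pushforward _ _ _ _ _ phi mphi leb setT (EFin \o f) measurableT.
rewrite preimage_setT => <-//; last 2 first.
- by apply/measurable_EFinP; exact: mf.
- by move=> y _; rewrite lee_fin.
pose nu : {measure set (measurableTypeR R) -> \bar R} :=
    @measure_function_pushforward__canonical__measure_function_Measure
      _ _ _ _ _ leb _ mphi.
have -> : (\int[pushforward leb phi]_x (f x)%:E = \int[nu]_x (f x)%:E)%E by [].
pose nu' : {measure set (measurableTypeR R) -> \bar R} :=
    mscale (NngNum (ltW r0)) nu.
have : (\int[nu']_x (f x)%:E = v%:E)%E.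
  rewrite -fv.2; apply: eq_measure_integral => A mA _.
  exact: esym (phiE A mA).
rewrite ge0_integral_mscale//; last 2 first.
- exact/measurable_EFinP.
- by move=> x _; rewrite lee_fin.
move=> /= /(congr1 (fun z => (r^-1)%:E * z)%E).
by rewrite muleA -EFinM mulVf ?gt_eqF// mul1e => ->; rewrite -EFinM mulrC.
Qed.

End Lebesgue.

(** * The Gamma integral and the moments of the gamma density *)

Section Gamma.
Variable R : realType.
Local Notation leb := (@lebesgue_measure R).
Implicit Types (c d t v : R).

(** The antiderivative x^c / c is nonnegative, so the bound is uniform in [t] even when [c < 1]
    makes the integrand blow up at 0. *)
Lemma integral_powR_itv c t : 0 < c -> 0 < t < 1 ->
  (\int[leb]_(x in `[t, 1%R]) (x `^ (c - 1))%:E <= (c^-1)%:E)%E.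
Proof.
move=> c0 /andP[t0 t1].
have dF (x : R) : 0 < x ->
    is_derive x (1 : R) (fun x : R => c^-1 * x `^ c) (x `^ (c - 1)).
  move=> x0; have dc := is_derive1_powR c x0.
  apply: is_derive_eq; rewrite -[LHS]/(c^-1 * (c * _)).
  by rewrite mulrA mulVf ?gt_eqF// mul1r.
have dp (p x : R) : 0 < x -> derivable (fun x : R => x `^ p) x 1.
  by move=> x0; have [] := is_derive1_powR p x0.
have cp (p x : R) : 0 < x -> {for x, continuous (fun x : R => x `^ p)}.
  by move=> x0; apply/differentiable_continuous; rewrite -derivable1_diffP; exact: dp.
rewrite (@continuous_FTC2 _ _ (fun x : R => c^-1 * x `^ c))//.
- by rewrite powR1 mulr1 -EFinB lee_fin lerBlDr lerDl mulr_ge0 ?invr_ge0 ?powR_ge0 ?ltW.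
- apply: derivable_within_continuous => x; rewrite in_itv/= => /andP[tx _].
  exact/dp/(lt_le_trans t0 tx).
- have cF (x : R) : 0 < x -> {for x, continuous (fun x : R => c^-1 * x `^ c)}.
    move=> x0; apply/differentiable_continuous; rewrite -derivable1_diffP.
    by have [] := dF x x0.
  split.
  + by move=> x; rewrite in_itv/= => /andP[tx _]; have [] := dF x (lt_trans t0 tx).
  + by apply: cvg_at_right_filter; exact: cF.
  + by apply: cvg_at_left_filter; exact: cF.
- move=> x; rewrite in_itv/= => /andP[tx _].
  by rewrite derive1E; have dFx := dF x (lt_trans t0 tx); rewrite derive_val.
Qed.

(** Monotone convergence along intervals that stay away from the possible singularity at 0. *)
Lemma has_integral_powR_unit c : 0 < c ->
  exists v, has_integral leb (fun t => if 0 < t <= 1 then t `^ (c - 1) else 0) v.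
Proof.
move=> c0; pose f t := t `^ (c - 1).
(* Starting at 2 keeps every left endpoint strictly below 1, as [integral_powR_itv] requires. *)
pose F (i : nat) : set (measurableTypeR R) := `[(i.+2%:R)^-1, 1]%classic.
have FE : (\bigcup_i F i = `]0, 1])%classic.
  apply/seteqP; split => x /=.
    move=> [i _]; rewrite /F/= !in_itv/= => /andP[ix ->]; rewrite andbT.
    by apply: lt_le_trans ix; rewrite invr_gt0.
  rewrite !in_itv/= => /andP[x0 x1].
  exists (Num.trunc x^-1) => //; rewrite /F/= in_itv/= x1 andbT.
  rewrite -[leRHS]invrK lef_pV2 ?posrE ?invr_gt0//.
  apply: ltW; apply: (lt_trans (truncnS_gt _)).
  by rewrite ltr_nat.
have mF i : measurable (F i) by exact: measurable_itv.
have ndF : nondecreasing_seq F.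
  move=> i j ij; rewrite subsetEset => x; rewrite /F/= !in_itv/= => /andP[ix ->].
  rewrite andbT; apply: le_trans ix.
  by rewrite lef_pV2 ?posrE// ler_nat !ltnS.
have mf : measurable_fun setT f by exact: measurable_powR.
have mFf i : measurable_fun (F i) (EFin \o f).
  by apply/measurable_EFinP; exact: measurable_funTS.
have f0 i x : F i x -> (0 <= (EFin \o f) x)%E by rewrite lee_fin powR_ge0.
have := @ge0_nondecreasing_set_cvg_integral _ _ _ F (EFin \o f) leb ndF mF mFf f0.
rewrite FE => H.
have le : (\int[leb]_(x in `]0%R, 1%R]) (EFin \o f) x <= (c^-1)%:E)%E.
  rewrite -(cvg_lim _ H)//; apply: lime_le; first by apply/cvg_ex; eexists; exact: H.
  apply: nearW => i; apply: integral_powR_itv => //.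
  by rewrite invr_gt0// ltr0n invf_lt1// ltr1n.
have fi : leb.-integrable `]0%R, 1%R] (EFin \o f).
  apply/integrableP; split; first by apply/measurable_EFinP; exact: measurable_funTS.
  under eq_integral do rewrite /= ger0_norm ?powR_ge0//.
  by rewrite (le_lt_trans le)// ltry.
apply: integrable_has_integral.
have := (integrable_mkcond (mu := leb) (EFin \o f) (measurable_itv `]0%R, 1%R])).1 fi.
apply: eq_integrable => // t _; rewrite patchE mem_setE in_itv/=.
by case: ifP.
Qed.


(** The value 0 for [t <= 0] turns integrals over the positive half-line into integrals over the
    whole line. *)
Definition gamma_fun c d t := if 0 < t then t `^ (c - 1) * expR (- (d * t)) else 0.

Lemma gamma_fun_ge0 c d t : 0 <= gamma_fun c d t.
Proof. by rewrite /gamma_fun; case: ifP => // _; rewrite mulr_ge0 ?powR_ge0 ?expR_ge0. Qed.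

Lemma measurable_gamma_fun c d : measurable_fun setT (gamma_fun c d).
Proof.
apply: measurable_fun_ifT => //; first by apply: measurable_fun_ltr.
apply: measurable_funM; first exact: measurable_powR.
by apply: measurableT_comp => //; apply: measurableT_comp.
Qed.

(** [1 + u <= expR u] at [u = ln (t / (2 * c))] gives c ln t <= t/2 + c ln(2c) - c, so half of the
    exponential decay absorbs the power. *)
Lemma powR_expR_le c t : 0 < c -> 1 <= t ->
  t `^ (c - 1) * expR (- t) <= expR (c * ln (2 * c)) * expR (- (2^-1 * t)).
Proof.
move=> c0 t1; have t0 : 0 < t by exact: lt_le_trans t1.
rewrite /powR gt_eqF// -!expRD ler_expR.
have lnt : 0 <= ln t by rewrite ln_ge0.
have := expR_ge1Dx (ln (t / (2 * c))).
rewrite lnK ?posrE ?divr_gt0 ?mulr_gt0// ln_div ?posrE ?mulr_gt0// => H.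
have {}H : c * (1 + (ln t - ln (2 * c))) <= t / 2.
  apply: (@le_trans _ _ (c * (t / (2 * c)))); first by rewrite ler_pM2l.
  by rewrite le_eqVlt; apply/orP; left; apply/eqP; field; rewrite gt_eqF.
lra.
Qed.

Lemma has_integral_gamma_fun1 c : 0 < c -> has_integral leb (gamma_fun c 1) (Gamma c).
Proof.
move=> c0.
have [v hv] := has_integral_powR_unit c0.
have he : has_integral leb (exponential_pdf (2^-1 : R)) 1.
  apply: ge0_has_integral.
  - exact: measurable_exponential_pdf.
  - by move=> x; apply: exponential_pdf_ge0.
  - exact: integral_exponential_pdf.
(* The exponential is the constant of [powR_expR_le]; the factor 2 cancels the rate 1/2 in the
   exponential density. *)
have hb := has_integralD hv (has_integralZ (2 * expR (c * ln (2 * c))) he).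
have [w hw] : exists w, has_integral leb (gamma_fun c 1) w.
  apply: (le_has_integral _ _ hb); first exact: measurable_gamma_fun.
  move=> t; rewrite ger0_norm ?gamma_fun_ge0// /gamma_fun mul1r.
  have e0 : 0 <= 2 * expR (c * ln (2 * c)) * exponential_pdf 2^-1 t.
    by rewrite !mulr_ge0 ?expR_ge0// exponential_pdf_ge0.
  case: (ltP 0 t) => /= t0; last by rewrite add0r.
  case: (leP t 1) => t1.
    rewrite -[leLHS]addr0 lerD// -[leRHS]mulr1 ler_wpM2l ?powR_ge0//.
    by rewrite -expR0 ler_expR oppr_le0 ltW.
  rewrite add0r (exponential_pdfE _ (ltW t0)).
  apply: le_trans (powR_expR_le c0 (ltW t1)) _.
  rewrite le_eqVlt; apply/orP; left; apply/eqP.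
  by rewrite mulNr; field.
suff -> : Gamma c = w by [].
rewrite /Gamma Rintegral_mkcond /Rintegral.
rewrite (_ : (fun _ => _) = (fun t => (gamma_fun c 1 t)%:E)) ?hw.2//.
apply/funext => t; rewrite patchE mem_setE in_itv/= andbT /gamma_fun mul1r.
by case: ifP.
Qed.

(** On [1, 2] the integrand is at least exp(-2) / 2, because [c - 1] exceeds -1. *)
Lemma Gamma_gt0 c : 0 < c -> 0 < Gamma c.
Proof.
move=> c0; have [gi gE] := has_integral_gamma_fun1 c0.
have le : (\int[leb]_(t in `[1%R, 2%R]) (cst (expR (- 2) / 2)%:E t) <= (Gamma c)%:E)%E.
  rewrite -gE [leLHS]integral_mkcond; apply: ge0_le_integral => //.
  - by move=> x _; rewrite erestrict_ge0// => y _; rewrite lee_fin divr_ge0 ?expR_ge0.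
  - by apply/(measurable_restrictT _ (measurable_itv _)); exact: measurable_cst.
  - by apply/measurable_EFinP; exact: measurable_gamma_fun.
  - move=> t _; rewrite patchE mem_setE in_itv/=; case: ifPn; last first.
      by rewrite lee_fin gamma_fun_ge0.
    move=> /andP[t1 t2]; have t0 : 0 < t by exact: lt_le_trans t1.
    rewrite lee_fin /gamma_fun t0 mul1r mulrC.
    apply: ler_pM; rewrite ?expR_ge0 ?invr_ge0//; last by rewrite ler_expR lerN2.
    apply: (@le_trans _ _ (t `^ (- 1))).
      by rewrite (powR_inv1 (ltW t0)) lef_pV2 ?posrE.
    by apply: ler_powR => //; lra.
have : (0 < \int[leb]_(t in `[1%R, 2%R]) (cst (expR (- 2) / 2)%:E t))%E.
  rewrite integral_cst//= lebesgue_measure_itv/= lte_fin ltr1n/= -EFinB -EFinM lte_fin.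
  by rewrite mulr_gt0 ?divr_gt0 ?expR_gt0//; lra.
by move=> /lt_le_trans/(_ le); rewrite lte_fin.
Qed.

(** Rescaling of the case [d = 1]. The power d^(-c) is written through [expR] and [ln], the form in
    which it is differentiated in both [c] and [d] below. *)
Lemma has_integral_gamma_fun c d : 0 < c -> 0 < d ->
  has_integral leb (gamma_fun c d) (Gamma c * expR (- (c * ln d))).
Proof.
move=> c0 d0.
have := ge0_has_integral_affine 0 d0 (gamma_fun_ge0 c 1) (has_integral_gamma_fun1 c0).
move/(has_integralZ (expR (- ((c - 1) * ln d)))).
rewrite (_ : _ * (_ / _) = Gamma c * expR (- (c * ln d))); last first.
  have {2}-> : d = expR (ln d) by rewrite lnK.
  rewrite mulrCA -expRN -expRD; congr (_ * expR _); ring.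
apply: has_integral_ext => t; rewrite /gamma_fun addr0 mul1r pmulr_rgt0//.
case: ifPn => t0; last by rewrite mulr0.
rewrite powRM ?ltW// mulrA; congr (_ * _).
by rewrite /powR (gt_eqF d0) mulrA -expRD addNr expR0 mul1r.
Qed.

Lemma has_integral_gamma_fun_id c d : 0 < c -> 0 < d ->
  has_integral leb (fun t => gamma_fun c d t * t) (c / d * (Gamma c * expR (- (c * ln d)))).
Proof.
move=> c0 d0.
(* Tilting by the statistic [-t] shifts the rate from [d] to [d + s]. *)
have [||t|s sd|z dz hz] := @has_integral_expfam _ _ _ leb (gamma_fun c d) -%R
  (fun s => Gamma c * expR (- (c * ln (d + s)))) d d0.
- exact: measurable_gamma_fun.
- exact: oppr_measurable.
- exact: gamma_fun_ge0.
- have ds : 0 < d + s by move: sd; rewrite ltr_norml => /andP[]; lra.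
  apply: has_integral_ext (has_integral_gamma_fun c0 ds) => t.
  rewrite /gamma_fun; case: ifP => _; last by rewrite mul0r.
  by rewrite -mulrA -expRD; congr (_ * expR _); ring.
have := has_integralZ (-1) hz.
rewrite (_ : -1 * z = c / d * (Gamma c * expR (- (c * ln d)))).
  by apply: has_integral_ext => t; ring.
have d0' : 0 < d + 0 by rewrite addr0.
have dl : is_derive (0 : R) (1 : R) (fun s => d + s) 1.
  by apply: is_derive_eq; rewrite add0r mulr1.
have dln := @is_derive1_comp _ _ _ _ _ _ (is_derive1_ln d0') dl.
have dZ : is_derive (0 : R) (1 : R) (fun s => - (c * ln (d + s))) (- (c * d^-1)).
  by apply: is_derive_eq; rewrite addr0 mulr1.
have dE := @is_derive1_comp _ _ _ _ _ _ (is_derive_expR _) dZ.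
have dM := @is_deriveZ _ _ _ _ (Gamma c) _ _ _ dE.
have -> := etrans (esym (derive_val (is_derive := dz))) (derive_val (is_derive := dM)).
by rewrite addr0 -[_ *: _]/(_ * _); ring.
Qed.

Lemma has_integral_gamma_fun_ln c d : 0 < c -> 0 < d ->
  has_integral leb (fun t => gamma_fun c d t * ln t)
    ((digamma c - ln d) * (Gamma c * expR (- (c * ln d)))).
Proof.
move=> c0 d0.
(* Tilting by [ln t] shifts the shape from [c] to [c + s]. *)
have H e : 0 < e -> exists2 z, is_derive (0 : R) (1 : R)
   (fun s => Gamma (c + s) * expR (- ((c + s) * ln e))) z
   & has_integral leb (fun t => gamma_fun c e t * ln t) z.
  move=> e0; apply: (has_integral_expfam c0) => //.
  - exact: measurable_gamma_fun.
  - exact: gamma_fun_ge0.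
  - move=> s sc; have cs : 0 < c + s by move: sc; rewrite ltr_norml => /andP[]; lra.
    apply: has_integral_ext (has_integral_gamma_fun cs e0) => t.
    rewrite /gamma_fun; case: ifP => t0; last by rewrite mul0r.
    by rewrite /powR gt_eqF// -!expRD; congr expR; ring.
(* At rate 1 the power of the rate disappears from [Z], so this instance makes Gamma itself
   differentiable at [c]; [digamma], defined by [derive1], carries no information otherwise. *)
have [z1 dz1 _] := H 1 ltr01; have [z dz hz] := H d d0.
have dG : is_derive (0 : R) (1 : R) (fun s => Gamma (c + s)) z1.
  move: dz1; congr is_derive; apply/funext => s.
  by rewrite ln1 mulr0 oppr0 expR0 mulr1.
have dGc : is_derive c (1 : R) (@Gamma R) z1.
  have c0' : c - c = 0 by rewrite subrr.
  have dl : is_derive c (1 : R) (fun s => s - c) 1.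
    by apply: is_derive_eq; rewrite subr0.
  have := @is_derive1_comp _ (fun s => Gamma (c + s)) (fun s => s - c) c z1 1.
  rewrite c0' => /(_ dG dl); rewrite mulr1; congr is_derive; apply/funext => s /=.
  by congr Gamma; ring.
have psi : digamma c = z1 / Gamma c.
  have := @is_derive1_comp _ _ _ _ _ _ (is_derive1_ln (Gamma_gt0 c0)) dGc.
  by rewrite /digamma derive1E mulrC => -[_ <-].
suff <- : z = (digamma c - ln d) * (Gamma c * expR (- (c * ln d))) by [].
have dl : is_derive (0 : R) (1 : R) (fun s => - ((c + s) * ln d)) (- ln d).
  by apply: is_derive_eq; rewrite scaler0 !add0r; congr (- _); exact: mulr1.
have dE := @is_derive1_comp _ _ _ _ _ _ (is_derive_expR _) dl.
have dM := @is_deriveM _ _ _ _ _ _ _ _ dG dE.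
have -> := etrans (esym (derive_val (is_derive := dz))) (derive_val (is_derive := dM)).
rewrite /= !addr0 psi.
rewrite -![_ *: _]/(_ * _).
by field; rewrite gt_eqF ?Gamma_gt0.
Qed.

End Gamma.

(** * Moments of the univariate Gaussian, parametrised by its precision *)

Section Gauss1.
Variable R : realType.
Local Notation leb := (@lebesgue_measure R).
Implicit Types (al m v k y h : R).

Definition gauss al m v : R := expR (- (al * (v - m) ^+ 2 / 2)).

Definition gauss_const al : R := Num.sqrt (2 * pi) * expR (- (ln al / 2)).

Lemma gauss_ge0 al m v : 0 <= gauss al m v. Proof. exact: expR_ge0. Qed.

Lemma measurable_gauss al m : measurable_fun setT (gauss al m).
Proof.
apply: measurableT_comp => //; apply: measurableT_comp => //.
apply: measurable_funM => //; apply: measurable_funM => //.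
by apply: measurable_funX; apply: measurable_funB.
Qed.

Lemma has_integral_gauss al m : 0 < al ->
  has_integral leb (gauss al m) (gauss_const al).
Proof.
move=> al0.
pose s := Num.sqrt al^-1.
have s0 : s != 0 by rewrite gt_eqF// sqrtr_gt0 invr_gt0.
have s2 : s ^+ 2 = al^-1 by rewrite sqr_sqrtr// invr_ge0 ltW.
have H : has_integral leb (normal_pdf m s) 1.
  apply: ge0_has_integral.
  - exact: measurable_normal_pdf.
  - exact: normal_pdf_ge0.
  - exact: integral_normal_pdf.
have e2 : expR (ln al / 2) ^+ 2 = al.
  by rewrite -expRM_natl mulrC divfK// lnK.
have sq : Num.sqrt al = expR (ln al / 2).
  by rewrite -{1}e2 sqrtr_sqr ger0_norm// expR_ge0.
have pkE : (normal_peak s)^-1 = gauss_const al.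
  rewrite /normal_peak invrK s2 /gauss_const expRN -sq -sqrtrV ?ltW//.
  rewrite -sqrtrM ?mulr_ge0 ?pi_ge0//; congr Num.sqrt.
  by rewrite -mulr_natl; ring.
have pk0 : normal_peak s != 0 by rewrite gt_eqF// normal_peak_gt0.
have := has_integralZ (normal_peak s)^-1 H.
rewrite mulr1 pkE; apply: has_integral_ext => v.
rewrite -pkE normal_pdfE// mulKf// /normal_fun s2 /gauss; congr expR.
by rewrite -mulr_natr; field; rewrite gt_eqF.
Qed.

Lemma has_integral_gauss_id al : 0 < al ->
  has_integral leb (fun v => gauss al 0 v * v) 0.
Proof.
move=> al0.
(* Tilting by [v] and completing the square moves the mean to [s / al] at the cost of the factor
   exp(s^2 / (2 al)), whose derivative at 0 vanishes. *)
have [||v|s _|z dz hz] := @has_integral_expfam _ _ _ leb (gauss al 0) id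
  (fun s => expR (s * s / al / 2) * gauss_const al) 1 ltr01.
- exact: measurable_gauss.
- by [].
- exact: gauss_ge0.
- have hs := has_integralZ (expR (s * s / al / 2)) (has_integral_gauss (s / al) al0).
  apply: has_integral_ext hs => v.
  by rewrite /gauss -!expRD; congr expR; field; rewrite gt_eqF.
suff z0 : z = 0 by move: hz; rewrite z0.
have ds : is_derive (0 : R) (1 : R) (fun s => s * s / al / 2) 0.
  pose c : R := al^-1 / 2.
  have dc : is_derive (0 : R) (1 : R) (fun s => s * s * c) 0.
    apply: is_derive_eq; rewrite ?(scaler0, scale0r, add0r, addr0)//.
  move: dc; congr is_derive; apply/funext => s; rewrite /c; ring.
have dE := @is_derive1_comp _ _ _ _ _ _ (is_derive_expR _) ds.
have dM := @is_deriveM _ _ _ (cst (gauss_const al)) _ _ _ _ dE (is_derive_cst _ _ _).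
have -> := etrans (esym (derive_val (is_derive := dz))) (derive_val (is_derive := dM)).
by rewrite mulr0 !scaler0 addr0.
Qed.

Lemma has_integral_gauss_sqr al : 0 < al ->
  has_integral leb (fun v => gauss al 0 v * v ^+ 2) (gauss_const al / al).
Proof.
move=> al0.
(* Tilting by [- (v ^+ 2 / 2)] raises the precision from [al] to [al + s]. *)
have [||v|s sa|z dz hz] := @has_integral_expfam _ _ _ leb (gauss al 0)
  (fun v => - (v ^+ 2 / 2)) (fun s => gauss_const (al + s)) al al0.
- exact: measurable_gauss.
- by apply: measurableT_comp => //; apply: measurable_funM.
- exact: gauss_ge0.
- have as0 : 0 < al + s by move: sa; rewrite ltr_norml => /andP[]; lra.
  apply: has_integral_ext (has_integral_gauss 0 as0) => v.
  by rewrite /gauss -!expRD; congr expR; field.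
have := has_integralZ (- 2) hz.
rewrite (_ : - 2 * z = gauss_const al / al).
  by apply: has_integral_ext => v; field.
have a0' : 0 < al + 0 by rewrite addr0.
have dl : is_derive (0 : R) (1 : R) (fun s => al + s) 1.
  by apply: is_derive_eq; rewrite add0r mulr1.
have dln := @is_derive1_comp _ _ _ _ _ _ (is_derive1_ln a0') dl.
have dZ : is_derive (0 : R) (1 : R) (fun s => - (2^-1 * ln (al + s))) (- (2^-1 * al^-1)).
  by apply: is_derive_eq; rewrite addr0 mulr1.
have dE := @is_derive1_comp _ _ _ _ _ _ (is_derive_expR _) dZ.
have dM := @is_deriveZ _ _ _ _ (Num.sqrt (2 * pi)) _ _ _ dE.
have zE : (fun s => gauss_const (al + s)) =
    Num.sqrt (2 * pi) \*: (expR \o (fun s => - (2^-1 * ln (al + s)))).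
  by apply/funext => s; rewrite /gauss_const [ln _ / 2]mulrC.
rewrite zE in dz.
have -> := etrans (esym (derive_val (is_derive := dz))) (derive_val (is_derive := dM)).
rewrite /= addr0 -[_ *: _]/(_ * _) /gauss_const [ln al / 2]mulrC.
by field; rewrite gt_eqF.
Qed.

(** The form [k + (y - h * v) ^+ 2] reproduces itself when a coordinate is integrated out, the
    variance [h ^+ 2 / al] being added to [k]; this drives the multivariate induction. [0 <= k]
    keeps the integrand nonnegative. *)
Lemma has_integral_gauss_quad al m k y h : 0 < al -> 0 <= k ->
  has_integral leb (fun v => gauss al m v * (k + (y - h * v) ^+ 2))
    (gauss_const al * (k + (y - h * m) ^+ 2 + h ^+ 2 / al)).
Proof.
move=> al0 k0; pose F v := gauss al 0 v * (k + (y - h * m - h * v) ^+ 2).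
have F0 v : 0 <= F v by rewrite mulr_ge0 ?gauss_ge0// addr_ge0// sqr_ge0.
have hF : has_integral leb F (gauss_const al * (k + (y - h * m) ^+ 2 + h ^+ 2 / al)).
  have H0 := has_integralZ (k + (y - h * m) ^+ 2) (has_integral_gauss 0 al0).
  have H1 := has_integralZ (- (2 * h * (y - h * m))) (has_integral_gauss_id al0).
  have H2 := has_integralZ (h ^+ 2) (has_integral_gauss_sqr al0).
  have := has_integralD (has_integralD H0 H1) H2; rewrite mulr0 addr0 => HF.
  rewrite (_ : gauss_const al * _ = (k + (y - h * m) ^+ 2) * gauss_const al
    + h ^+ 2 * (gauss_const al / al)); last by ring.
  by apply: has_integral_ext HF => v; rewrite /F; ring.
have := ge0_has_integral_affine (- m) ltr01 F0 hF.
rewrite divr1; apply: has_integral_ext => v.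
rewrite /F /gauss mul1r subr0; congr (_ * _); ring.
Qed.

End Gauss1.

(** * Multivariate Gaussian and normal-gamma moments *)

Section DotQuad.
Variable R : realType.
Implicit Types (d : nat) (r s : R).

Lemma dotC d (u v : 'cV[R]_d) : dot u v = dot v u.
Proof. by rewrite /dot -{1}[v]trmxK -trmx_mul mxE. Qed.

Lemma dotE d (u v : 'cV[R]_d) : dot u v = \sum_i u i 0 * v i 0.
Proof. by rewrite /dot mxE; apply: eq_bigr => i _; rewrite mxE. Qed.

Lemma dotDr d (u v w : 'cV[R]_d) : dot u (v + w) = dot u v + dot u w.
Proof. by rewrite /dot mulmxDr mxE. Qed.

Lemma dotZr d (u v : 'cV[R]_d) r : dot u (r *: v) = r * dot u v.
Proof. by rewrite /dot -scalemxAr mxE. Qed.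

Lemma dotNr d (u v : 'cV[R]_d) : dot u (- v) = - dot u v.
Proof. by rewrite -scaleN1r dotZr mulN1r. Qed.

Lemma dotBr d (u v w : 'cV[R]_d) : dot u (v - w) = dot u v - dot u w.
Proof. by rewrite dotDr dotNr. Qed.

Lemma dotDl d (u v w : 'cV[R]_d) : dot (v + w) u = dot v u + dot w u.
Proof. by rewrite dotC dotDr !(dotC u). Qed.

Lemma dotZl d (u v : 'cV[R]_d) r : dot (r *: v) u = r * dot v u.
Proof. by rewrite dotC dotZr (dotC u). Qed.

Lemma dotBl d (u v w : 'cV[R]_d) : dot (v - w) u = dot v u - dot w u.
Proof. by rewrite dotC dotBr !(dotC u). Qed.

Lemma dot0r d (u : 'cV[R]_d) : dot u 0 = 0.
Proof. by rewrite -(scale0r 0) dotZr mul0r. Qed.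

Lemma dot_tr d e (A : 'M[R]_(d, e)) u v : dot (A *m u) v = dot u (A^T *m v).
Proof. by rewrite /dot trmx_mul mulmxA. Qed.

Lemma dot_col_mx d r s (u v : 'cV[R]_d) :
  dot (col_mx r%:M u : 'cV[R]_(1 + d)) (col_mx s%:M v) = r * s + dot u v.
Proof.
rewrite /dot tr_col_mx mul_row_col mxE tr_scalar_mx mul_scalar_mx scale_scalar_mx.
by rewrite !mxE eqxx mulr1n.
Qed.

Lemma quadE d (A : 'M[R]_d) v : quad A v = dot v (A *m v).
Proof. by rewrite /quad /dot mulmxA. Qed.

Lemma quadZ d (A : 'M[R]_d) r v : quad (r *: A) v = r * quad A v.
Proof. by rewrite !quadE -scalemxAl dotZr. Qed.

Lemma quad_col_mx d (al : R) (be : 'cV[R]_d) (C : 'M[R]_d) r w :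
  quad (block_mx al%:M be^T be C : 'M[R]_(1 + d)) (col_mx r%:M w)
  = al * r ^+ 2 + 2 * r * dot be w + quad C w.
Proof.
rewrite quadE mul_block_col [be^T *m w]mx11_scalar -/(dot be w).
rewrite mul_scalar_mx scale_scalar_mx -raddfD/= mul_mx_scalar dot_col_mx.
by rewrite dotDr dotZr quadE (dotC w be); ring.
Qed.

Definition schur d (al : R) (be : 'cV[R]_d) (C : 'M[R]_d) := C - al^-1 *: (be *m be^T).

Lemma quad_schur d (al : R) (be : 'cV[R]_d) (C : 'M[R]_d) w :
  quad (schur al be C) w = quad C w - al^-1 * dot be w ^+ 2.
Proof.
rewrite !quadE mulmxBl dotBr -scalemxAl dotZr -mulmxA [be^T *m w]mx11_scalar.
by rewrite -/(dot be w) mul_mx_scalar dotZr [dot w be]dotC expr2.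
Qed.

(** Completing the square in the first coordinate: for a centred Gaussian, given [w] it has
    precision [al] and mean [- (dot be w / al)]. *)
Lemma quad_block_schur d (al : R) (be : 'cV[R]_d) (C : 'M[R]_d) r w : al != 0 ->
  quad (block_mx al%:M be^T be C : 'M[R]_(1 + d)) (col_mx r%:M w)
  = al * (r + dot be w / al) ^+ 2 + quad (schur al be C) w.
Proof. by move=> al0; rewrite quad_col_mx quad_schur; field. Qed.

Lemma det_block_schur d (al : R) (be : 'cV[R]_d) (C : 'M[R]_d) : al != 0 ->
  \det (block_mx al%:M be^T be C : 'M[R]_(1 + d)) = al * \det (schur al be C).
Proof.
move=> al0.
(* One step of block elimination; the left factor is unit lower triangular. *)
have -> : (block_mx al%:M be^T be C : 'M[R]_(1 + d)) =
    block_mx 1%:M 0 (al^-1 *: be) 1%:M *m block_mx al%:M be^T 0 (schur al be C).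
  rewrite mulmx_block !mul1mx !mul0mx !addr0.
  rewrite mul_mx_scalar scalerA divff// scale1r -scalemxAl /schur.
  by congr block_mx; rewrite addrC subrK.
by rewrite det_mulmx det_lblock det_ublock !det1 !mul1r det_scalar1.
Qed.

Lemma sym_block d (A : 'M[R]_(1 + d)) : A^T = A ->
  exists al be C, A = block_mx al%:M be^T be C /\ C^T = C.
Proof.
move=> sA; exists (ulsubmx A 0 0), (dlsubmx A), (drsubmx A); split.
  rewrite -[LHS]submxK -mx11_scalar; congr block_mx.
  by rewrite trmx_dlsub sA.
by rewrite trmx_drsub sA.
Qed.

Lemma posdef_block d (al : R) (be : 'cV[R]_d) (C : 'M[R]_d) :
  sym_posdef (block_mx al%:M be^T be C : 'M[R]_(1 + d)) -> 0 < al.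
Proof.
move=> [_ /(_ (col_mx 1%:M 0))]; rewrite quad_col_mx expr1n mulr1 dot0r mulr0 addr0.
rewrite quadE mulmx0 dot0r addr0; apply.
apply/eqP => /(congr1 usubmx); rewrite col_mxKu linear0 => /matrixP/(_ 0 0).
by rewrite !mxE eqxx => /eqP; rewrite oner_eq0.
Qed.

Lemma posdef_schur d (al : R) (be : 'cV[R]_d) (C : 'M[R]_d) : C^T = C ->
  sym_posdef (block_mx al%:M be^T be C : 'M[R]_(1 + d)) -> sym_posdef (schur al be C).
Proof.
move=> sC pA; have al0 := posdef_block pA; split.
  by rewrite /schur linearB linearZ/= trmx_mul trmxK sC.
(* This first coordinate makes the completed square vanish, so only the Schur form is left. *)
move=> w w0; have := pA.2 (col_mx (- (dot be w / al))%:M w).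
rewrite quad_block_schur ?gt_eqF// addNr expr0n mulr0 add0r; apply.
apply: contra_neq w0 => /(congr1 dsubmx).
by rewrite col_mxKd linear0.
Qed.

Lemma det_posdef_gt0 d (A : 'M[R]_d) : sym_posdef A -> 0 < \det A.
Proof.
elim: d A => [|d IH] A; first by rewrite det_mx00.
move=> pA; have [al [be [C [AE sC]]]] := @sym_block d A pA.1.
have : sym_posdef (block_mx al%:M be^T be C : 'M[R]_(1 + d)) by rewrite -AE.
move=> pB; have al0 := posdef_block pB.
rewrite AE det_block_schur ?gt_eqF// mulr_gt0//.
exact/IH/(posdef_schur sC pB).
Qed.

Lemma posdef_unit d (A : 'M[R]_d) : sym_posdef A -> A \in unitmx.
Proof. by move=> /det_posdef_gt0 A0; rewrite unitmxE unitfE gt_eqF. Qed.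

Lemma quad_invmx d (A : 'M[R]_d) v : A^T = A -> A \in unitmx ->
  quad (invmx A) (A *m v) = quad A v.
Proof.
move=> sA uA; rewrite !quadE mulmxA mulVmx// mul1mx dotC.
by [].
Qed.

(** Solve [A *m z = col_mx r%:M h] by eliminating the first coordinate; the blocks of [z] are [u]
    and [w]. The inverse form at [A *m z] is [quad A z], which the completed square evaluates. *)
Lemma quad_invmx_schur d (al : R) (be : 'cV[R]_d) (C : 'M[R]_d) r h : C^T = C ->
  sym_posdef (block_mx al%:M be^T be C : 'M[R]_(1 + d)) ->
  quad (invmx (block_mx al%:M be^T be C : 'M[R]_(1 + d))) (col_mx r%:M h)
  = r ^+ 2 / al + quad (invmx (schur al be C)) (h - (r / al) *: be).
Proof.
move=> sC pA; have al0 := posdef_block pA; have pS := posdef_schur sC pA.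
have al0' : al != 0 by rewrite gt_eqF.
pose w := invmx (schur al be C) *m (h - (r / al) *: be).
have Sw : schur al be C *m w = h - (r / al) *: be.
  by rewrite /w mulmxA mulmxV ?mul1mx// posdef_unit.
pose u := (r - dot be w) / al.
have -> : col_mx r%:M h =
    (block_mx al%:M be^T be C : 'M[R]_(1 + d)) *m col_mx u%:M w.
  rewrite mul_block_col [be^T *m w]mx11_scalar -/(dot be w).
  rewrite mul_scalar_mx scale_scalar_mx -raddfD/= mul_mx_scalar.
  congr col_mx; first by congr (_%:M); rewrite /u; field.
  have -> : C *m w = schur al be C *m w + (dot be w / al) *: be.
    rewrite /schur mulmxBl -scalemxAl -mulmxA [be^T *m w]mx11_scalar.
    by rewrite -/(dot be w) mul_mx_scalar scalerA [_^-1 * _]mulrC subrK.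
  by rewrite Sw; apply/matrixP => i j; rewrite !mxE /u; field.
rewrite quad_invmx ?posdef_unit//; last exact: pA.1.
rewrite quad_block_schur// -Sw quad_invmx ?posdef_unit//; last exact: pS.1.
by congr (_ + _); rewrite /u; field.
Qed.

End DotQuad.

(** * Multivariate Gaussian integrals by induction on the dimension *)

Section Gauss.
Variable R : realType.
Local Notation leb := (@lebesgue_measure R).

Definition colt d (z : d.-tuple (measurableTypeR R)) : 'cV[R]_d := \col_i tnth z i.

Lemma colt_tcons d (z : measurableTypeR R * d.-tuple (measurableTypeR R)) :
  colt (tcons z) = col_mx (z.1)%:M (colt z.2) :> 'cV[R]_(1 + d).
Proof.
apply/matrixP => i j; rewrite ord1 {j}.
case: (split_ordP i) => k ->.
  rewrite col_mxEu mxE ord1 mxE eqxx mulr1n.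
  by rewrite (_ : lshift d 0 = ord0) ?tnth_tcons0//; exact/val_inj.
rewrite col_mxEd !mxE (_ : rshift 1 k = lift ord0 k) ?tnth_tconsS//.
exact/val_inj.
Qed.

Section Measurability.
Context d (T : measurableType d).

Lemma measurable_dot n (u : 'cV[R]_n) (f : T -> 'cV[R]_n) :
  (forall i, measurable_fun setT (fun x => f x i 0)) ->
  measurable_fun setT (fun x => dot u (f x)).
Proof.
move=> mf; rewrite (_ : (fun _ => _) = (fun x => \sum_i u i 0 * f x i 0)).
  by apply: measurable_sum => i; exact: measurable_funM.
by apply/funext => x; rewrite dotE.
Qed.

Lemma measurable_quad n (A : 'M[R]_n) (f : T -> 'cV[R]_n) :
  (forall i, measurable_fun setT (fun x => f x i 0)) ->
  measurable_fun setT (fun x => quad A (f x)).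
Proof.
move=> mf; rewrite (_ : (fun _ => _) =
    (fun x => \sum_i f x i 0 * \sum_j A i j * f x j 0)).
  apply: measurable_sum => i; apply: measurable_funM => //.
  by apply: measurable_sum => j; exact: measurable_funM.
apply/funext => x; rewrite quadE dotE; apply: eq_bigr => i _.
by rewrite mxE.
Qed.

Lemma measurable_coltB n (f : T -> n.-tuple (measurableTypeR R)) (m : 'cV[R]_n) i :
  measurable_fun setT f -> measurable_fun setT (fun x => (colt (f x) - m) i 0).
Proof.
move=> mf; rewrite (_ : (fun _ => _) = (fun x => tnth (f x) i - m i 0)).
  apply: measurable_funB => //.
  exact: (measurableT_comp (@measurable_tnth _ _ _ i)).
by apply/funext => x; rewrite !mxE.
Qed.

Lemma measurable_colt n (f : T -> n.-tuple (measurableTypeR R)) i :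
  measurable_fun setT f -> measurable_fun setT (fun x => (colt (f x)) i 0).
Proof.
move=> mf; rewrite (_ : (fun _ => _) = (fun x => tnth (f x) i)).
  exact: (measurableT_comp (@measurable_tnth _ _ _ i)).
by apply/funext => x; rewrite !mxE.
Qed.

End Measurability.

Definition mvgauss d (A : 'M[R]_d) (m v : 'cV[R]_d) : R := expR (- (quad A (v - m) / 2)).

Definition mvgauss_const d (A : 'M[R]_d) : R :=
  Num.sqrt (2 * pi) ^+ d * expR (- (ln (\det A) / 2)).

Lemma mvgauss_ge0 d (A : 'M[R]_d) m v : 0 <= mvgauss A m v.
Proof. exact: expR_ge0. Qed.

(** [m], [k], [y] and [h] vary in the induction, because integrating out the first coordinate
    changes them all. Keeping [k] lets one induction yield both the normalising constant ([k = 1],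
    [y = 0], [h = 0]) and second moments ([k = 0]). *)
Lemma has_integral_mvgauss d (A : 'M[R]_d) (m h : 'cV[R]_d) (k y : R) :
  sym_posdef A -> 0 <= k ->
  has_integral (@tuple_measure _ _ _ leb d)
    (fun z => mvgauss A m (colt z) * (k + (y - dot h (colt z)) ^+ 2))
    (mvgauss_const A * (k + (y - dot h m) ^+ 2 + quad (invmx A) h)).
Proof.
elim: d A m h k y => [|d IH] A m h k y pA k0.
  have := has_integral_tuple0 leb
    (fun z => mvgauss A m (colt z) * (k + (y - dot h (colt z)) ^+ 2)).
  congr has_integral.
  rewrite /mvgauss /mvgauss_const /quad /dot !flatmx0 !mulmx0 !mxE det_mx00 ln1.
  by rewrite !mul0r expr0 mul1r addr0.
have [al [be [C [AE sC]]]] := @sym_block _ d A pA.1.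
have pB : sym_posdef (block_mx al%:M be^T be C : 'M[R]_(1 + d)) by rewrite -AE.
have al0 := posdef_block pB; have pS := posdef_schur sC pB.
have al0' : al != 0 by rewrite gt_eqF.
have colE (u : 'cV[R]_(1 + d)) : exists r w, u = col_mx r%:M w.
  exists (usubmx u 0 0), (dsubmx u).
  by rewrite -mx11_scalar vsubmxK.
have [m0 [m2 mE]] := colE m; have [h0 [h2 hE]] := colE h.
(* Given the other coordinates [w], the first has mean [m0 - dot be (w - m2) / al] and variance
   [al^-1]. Inserting this mean turns the residual into [y' - dot h' w]; the variance goes into
   [k']. *)
pose k' := k + h0 ^+ 2 / al.
pose y' := y - h0 * m0 - h0 / al * dot be m2.
pose h' := h2 - (h0 / al) *: be.
have k'0 : 0 <= k' by rewrite addr_ge0// divr_ge0 ?sqr_ge0 ?ltW.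
have IHS := IH _ m2 h' k' y' pS k'0.
have mf : measurable_fun setT (fun z : d.+1.-tuple (measurableTypeR R) =>
    mvgauss A m (colt z) * (k + (y - dot h (colt z)) ^+ 2)).
  apply: measurable_funM; last first.
    apply: measurable_funD => //; apply: measurable_funX; apply: measurable_funB => //.
    by apply: measurable_dot => i; exact: measurable_colt.
  apply: measurableT_comp => //; apply: measurableT_comp => //.
  apply: measurable_funM => //; apply: measurable_quad => i.
  exact: measurable_coltB.
apply: has_integral_tcons => //.
have := has_integralZ (gauss_const al) IHS.
have -> : gauss_const al * (mvgauss_const (schur al be C) *
     (k' + (y' - dot h' m2) ^+ 2 + quad (invmx (schur al be C)) h')) =
   mvgauss_const A * (k + (y - dot h m) ^+ 2 + quad (invmx A) h).
  rewrite AE hE mE quad_invmx_schur// dot_col_mx -/h'.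
  rewrite /mvgauss_const det_block_schur// lnM ?posrE ?det_posdef_gt0//.
  rewrite /gauss_const [(ln al + _) / 2]mulrDl [- (ln al / 2 + _)]opprD expRD.
  rewrite [_ ^+ d.+1]exprS /k' /y' /h' dotBl dotZl.
  ring.
apply: ge0_has_integral_fubini.
- exact: (measurableT_comp mf (@measurable_tcons _ _ _)).
- by move=> z; rewrite /= mulr_ge0 ?mvgauss_ge0// addr_ge0// sqr_ge0.
- move=> z /=.
  have := has_integralZ (mvgauss (schur al be C) m2 (colt z))
    (has_integral_gauss_quad (m0 - dot be (colt z - m2) / al) (y - dot h2 (colt z)) h0 al0 k0).
  have -> : mvgauss (schur al be C) m2 (colt z) * (gauss_const al *
   (k + (y - dot h2 (colt z) - h0 * (m0 - dot be (colt z - m2) / al)) ^+ 2 +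
    h0 ^+ 2 / al)) = gauss_const al *
     (mvgauss (schur al be C) m2 (colt z) *
      (k' + (y' - dot h' (colt z)) ^+ 2)).
    by rewrite /k' /y' /h' dotBl dotZl dotBr; field.
  apply: has_integral_ext => x.
  rewrite colt_tcons hE mE AE dot_col_mx mulrA /mvgauss /gauss.
  rewrite (@opp_col_mx _ 1 d) (@add_col_mx _ 1 d) -raddfB/= quad_block_schur//.
  rewrite -expRD; congr (expR _ * (_ + _ ^+ 2)); last by ring.
  by field.
Qed.

End Gauss.

(** * Normal-gamma densities and their moments *)

Section NormalGamma.
Variables (R : realType).
Local Notation leb := (@lebesgue_measure R).
Implicit Types (c d t : R).

Definition gamma_density (c d t : R) := d `^ c / Gamma c * gamma_fun c d t.

Lemma gamma_density_ge0 c d t : 0 < c -> 0 <= gamma_density c d t.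
Proof.
by move=> c0; rewrite mulr_ge0 ?gamma_fun_ge0// divr_ge0 ?powR_ge0// ltW// Gamma_gt0.
Qed.

Lemma gamma_const c d : 0 < c -> 0 < d ->
  d `^ c / Gamma c * (Gamma c * expR (- (c * ln d))) = 1.
Proof.
move=> c0 d0; rewrite mulrA divfK ?gt_eqF ?Gamma_gt0//.
by rewrite /powR gt_eqF// -expRD subrr expR0.
Qed.

Lemma has_integral_gamma_density c d : 0 < c -> 0 < d ->
  has_integral leb (gamma_density c d) 1.
Proof.
move=> c0 d0; rewrite -(gamma_const c0 d0).
exact: (has_integralZ _ (has_integral_gamma_fun c0 d0)).
Qed.

Lemma has_integral_gamma_density_id c d : 0 < c -> 0 < d ->
  has_integral leb (fun t => gamma_density c d t * t) (c / d).
Proof.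
move=> c0 d0; have := has_integralZ (d `^ c / Gamma c) (has_integral_gamma_fun_id c0 d0).
rewrite mulrCA gamma_const// mulr1; apply: has_integral_ext => t.
by rewrite mulrA.
Qed.

Lemma has_integral_gamma_density_ln c d : 0 < c -> 0 < d ->
  has_integral leb (fun t => gamma_density c d t * ln t) (digamma c - ln d).
Proof.
move=> c0 d0; have := has_integralZ (d `^ c / Gamma c) (has_integral_gamma_fun_ln c0 d0).
rewrite mulrCA gamma_const// mulr1; apply: has_integral_ext => t.
by rewrite mulrA.
Qed.

Lemma posdefZ (d : nat) (A : 'M[R]_d) (t : R) : 0 < t -> sym_posdef A -> sym_posdef (t *: A).
Proof.
move=> t0 [sA pA]; split; first by rewrite linearZ/= sA.
by move=> v v0; rewrite quadZ mulr_gt0// pA.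
Qed.

Lemma quad_invmxZ (d : nat) (A : 'M[R]_d) (t : R) v : 0 < t -> sym_posdef A ->
  quad (invmx (t *: A)) v = t^-1 * quad (invmx A) v.
Proof. by move=> t0 pA; rewrite invmxZ ?quadZ// unitmxZ ?posdef_unit// unitfE gt_eqF. Qed.

Lemma mvgauss_const_gt0 (d : nat) (A : 'M[R]_d) : 0 < mvgauss_const A.
Proof. by rewrite mulr_gt0 ?expR_gt0// exprn_gt0// sqrtr_gt0 mulr_gt0 ?pi_gt0. Qed.

Lemma mvnormal_pdfE (d : nat) (A : 'M[R]_d) m v : sym_posdef A ->
  mvnormal_pdf m (invmx A) v = (mvgauss_const A)^-1 * mvgauss A m v.
Proof.
move=> pA; have dA := det_posdef_gt0 pA.
rewrite /mvnormal_pdf /mvgauss /mvgauss_const invmxK; congr (_^-1 * _).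
have e2 : expR (ln (\det A) / 2) ^+ 2 = \det A.
  by rewrite -expRM_natl mulrC divfK// lnK.
have p2 : 0 <= 2 * pi :> R by rewrite mulr_ge0 ?pi_ge0.
rewrite det_inv sqrtrM ?exprn_ge0// expRN; congr (_ * _).
  elim: d {A m v pA dA e2} => [|d IH]; first by rewrite !expr0 sqrtr1.
  by rewrite !exprS sqrtrM// IH.
by rewrite sqrtrV ?ltW// -{1}e2 sqrtr_sqr ger0_norm// expR_ge0.
Qed.

Variable K : nat.
Implicit Types (m h : 'cV[R]_K.+1) (L : 'M[R]_K.+1) (y : R).

(** For [z.2 <= 0] the Gaussian factor has no meaning as a density, but the gamma factor is 0
    there. *)
Definition ng_density m L c d (z : leaf_param R K) : R :=
  gamma_density c d z.2 *
  ((mvgauss_const (z.2 *: L))^-1 * mvgauss (z.2 *: L) m (colt z.1)).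

Lemma ng_densityE m L c d z : sym_posdef L ->
  ng_density m L c d z =
  if 0 < z.2 then normal_gamma_pdf m L c d (colt z.1) z.2 else 0.
Proof.
move=> pL; rewrite /ng_density /gamma_density /gamma_fun.
case: ifPn => z0; last by rewrite mulr0 mul0r.
rewrite /normal_gamma_pdf mvnormal_pdfE; last exact: posdefZ.
by rewrite /gamma_pdf mulrC !mulrA.
Qed.

Lemma ng_density_ge0 m L c d z : 0 < c -> 0 <= ng_density m L c d z.
Proof.
move=> c0; rewrite mulr_ge0 ?gamma_density_ge0// mulr_ge0 ?mvgauss_ge0//.
by rewrite invr_ge0 ltW// mvgauss_const_gt0.
Qed.

Lemma measurable_ng_density m L c d : measurable_fun setT (ng_density m L c d).
Proof.
apply: measurable_funM.
  apply: measurable_funM => //.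
  by apply: (measurableT_comp (measurable_gamma_fun c d)); exact: measurable_snd.
apply: measurable_funM; last first.
  apply: measurableT_comp => //; apply: measurableT_comp => //.
  apply: measurable_funM => //.
  under eq_fun do rewrite quadZ.
  apply: measurable_funM; first exact: measurable_snd.
  by apply: measurable_quad => i; apply: measurable_coltB; exact: measurable_fst.
(* As det(tau L) = tau^(K+1) det L, the normalising constant becomes an explicit measurable function
   of tau. *)
rewrite (_ : (fun _ => _) = (fun z : leaf_param R K => (Num.sqrt (2 * pi) ^+ K.+1)^-1
  * expR (ln (z.2 ^+ K.+1 * \det L) / 2))); last first.
  by apply/funext => z; rewrite /mvgauss_const detZ invfM expRN invrK.
apply: measurable_funM => //; apply: measurableT_comp => //.
apply: measurable_funM => //; apply: measurableT_comp => //.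
apply: measurable_funM => //; apply: measurable_funX; exact: measurable_snd.
Qed.

Let leaf_fubini := @ge0_has_integral_fubini _ _ _ _ R
  (@tuple_measure _ _ _ leb K.+1) leb.

Lemma has_integral_mvgauss_inner m L h y (k t : R) : 0 < t -> sym_posdef L -> 0 <= k ->
  has_integral (@tuple_measure _ _ _ leb K.+1)
    (fun z => (mvgauss_const (t *: L))^-1 * mvgauss (t *: L) m (colt z)
       * (k + (y - dot h (colt z)) ^+ 2))
    (k + (y - dot h m) ^+ 2 + t^-1 * quad (invmx L) h).
Proof.
move=> t0 pL k0.
have := has_integralZ (mvgauss_const (t *: L))^-1
  (has_integral_mvgauss m h y (posdefZ t0 pL) k0).
rewrite mulKf ?gt_eqF ?mvgauss_const_gt0// quad_invmxZ//.
by apply: has_integral_ext => z; rewrite mulrA.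
Qed.

Lemma has_integral_ng m L c d (w : R -> R) v : sym_posdef L -> 0 < c -> 0 < d ->
  measurable_fun setT w ->
  has_integral leb (fun t => gamma_density c d t * w t) v ->
  has_integral (leaf_lebesgue R K) (fun z => ng_density m L c d z * w z.2) v.
Proof.
move=> pL c0 d0 mw hw; have [u hu] := has_integral_abs hw.
have inner (f : R -> R) t : has_integral (@tuple_measure _ _ _ leb K.+1)
    (fun x => ng_density m L c d (x, t) * f t) (gamma_density c d t * f t).
  have [t0|t0] := ltP 0 t; last first.
    rewrite /ng_density /gamma_density /gamma_fun/= ltNge t0/= mulr0 mul0r.
    by apply: has_integral_ext (has_integral0 _) => x; rewrite !mul0r.
  (* With [h = 0], [y = 0], [k = 1] the quadratic factor is 1, and the inner integral is the mass of
     the Gaussian. *)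
  have := has_integral_mvgauss_inner m 0 0 t0 pL ler01.
  rewrite /quad mulmx0 mxE mulr0 addr0 dotC dot0r subr0 expr0n addr0.
  move=> /(has_integralZ (gamma_density c d t * f t)); rewrite mulr1.
  apply: has_integral_ext => z; rewrite dotC dot0r subr0 expr0n addr0 mulr1.
  by rewrite /ng_density/= mulrAC.
have mf : measurable_fun setT (fun z : leaf_param R K => ng_density m L c d z * w z.2).
  apply: measurable_funM; first exact: measurable_ng_density.
  by apply: (measurableT_comp mw); exact: measurable_snd.
apply: (has_integral_fubini mf _ (inner w) hu hw) => t.
have := inner (fun t => `|w t|) t.
rewrite normrM [`|gamma_density c d t|]ger0_norm ?gamma_density_ge0//.
apply: has_integral_ext => x /=.
by rewrite normrM [`|ng_density m L c d (x, t)|]ger0_norm ?ng_density_ge0.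
Qed.

(** Given tau, the expectation is tau (y - h^T m)^2 + h^T L^(-1) h: the factor tau cancels the 1/tau
    of the conditional covariance. What remains is the mean and the mass of the gamma law. *)
Lemma has_integral_ng_sqr m L c d h y : sym_posdef L -> 0 < c -> 0 < d ->
  has_integral (leaf_lebesgue R K)
    (fun z => ng_density m L c d z * (z.2 * (y - dot h (colt z.1)) ^+ 2))
    (c / d * (y - dot h m) ^+ 2 + quad (invmx L) h).
Proof.
move=> pL c0 d0.
have mf : measurable_fun setT (fun z : leaf_param R K =>
    ng_density m L c d z * (z.2 * (y - dot h (colt z.1)) ^+ 2)).
  apply: measurable_funM; first exact: measurable_ng_density.
  apply: measurable_funM; first exact: measurable_snd.
  apply: measurable_funX; apply: measurable_funB => //.
  by apply: measurable_dot => i; apply: measurable_colt; exact: measurable_fst.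
have H := has_integralD
  (has_integralZ ((y - dot h m) ^+ 2) (has_integral_gamma_density_id c0 d0))
  (has_integralZ (quad (invmx L) h) (has_integral_gamma_density c0 d0)).
rewrite mulr1 mulrC in H.
apply: (leaf_fubini mf _ _ H).
  move=> z; have [z0|z0] := ltP 0 z.2; last first.
    by rewrite /ng_density /gamma_density /gamma_fun ltNge z0/= mulr0 !mul0r.
  by rewrite mulr_ge0 ?ng_density_ge0// mulr_ge0 ?sqr_ge0// (ltW z0).
move=> t /=; have [t0|t0] := ltP 0 t; last first.
  rewrite /ng_density /gamma_density /gamma_fun/= ltNge t0/= !(mulr0, mul0r) addr0.
  by apply: has_integral_ext (has_integral0 _) => x; rewrite !mul0r.
have := has_integralZ (gamma_density c d t * t)
  (has_integral_mvgauss_inner m h y t0 pL (lexx 0)).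
rewrite add0r.
have -> : gamma_density c d t * t * ((y - dot h m) ^+ 2 + t^-1 * quad (invmx L) h)
  = (y - dot h m) ^+ 2 * (gamma_density c d t * t) +
      quad (invmx L) h * gamma_density c d t.
  by field; rewrite gt_eqF.
apply: has_integral_ext => z; rewrite add0r /ng_density/=; ring.
Qed.

End NormalGamma.

(** * Expected logarithms under a normal-gamma law *)

Section NormalGammaLog.
Variables (R : realType) (K : nat).
Local Notation leb := (@lebesgue_measure R).
Variables (m : 'cV[R]_K.+1) (L : 'M[R]_K.+1) (c d : R).
Hypotheses (pL : sym_posdef L) (c0 : 0 < c) (d0 : 0 < d).
Implicit Types (z : leaf_param R K) (h mu : 'cV[R]_K.+1) (y tau : R).
Local Notation ng := (ng_density m L c d).
Local Notation leaf_integral := (has_integral (leaf_lebesgue R K)).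

Lemma has_integral_ng1 : leaf_integral ng 1.
Proof.
have H : has_integral leb (fun t => gamma_density c d t * cst 1 t) 1.
  by apply: has_integral_ext (has_integral_gamma_density c0 d0) => t; rewrite mulr1.
by apply: has_integral_ext (has_integral_ng m pL c0 d0 _ H) => // z; rewrite mulr1.
Qed.

Lemma has_integral_ng_ln : leaf_integral (fun z => ng z * ln z.2) (digamma c - ln d).
Proof.
exact: (has_integral_ng m pL c0 d0 (@measurable_ln R) (has_integral_gamma_density_ln c0 d0)).
Qed.

Lemma has_integral_ng_tau : leaf_integral (fun z => ng z * z.2) (c / d).
Proof.
exact: (has_integral_ng m pL c0 d0 (@measurable_id _ _ _)
  (has_integral_gamma_density_id c0 d0)).
Qed.

(** Polarisation: a product of two coordinates is half of the square of their sum minus their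
    squares, which reduces the form to squares of linear forms. Existence of the value suffices,
    because the prior term it belongs to does not involve the contexts. *)
Lemma has_integral_ng_quad (A : 'M[R]_K.+1) mu :
  exists v, leaf_integral (fun z => ng z * (z.2 * quad A (colt z.1 - mu))) v.
Proof.
pose e i : 'cV[R]_K.+1 := delta_mx i 0.
pose S h z := ng z * (z.2 * (dot h mu - dot h (colt z.1)) ^+ 2).
have HS h := has_integral_ng_sqr m h (dot h mu) pL c0 d0.
have Hij i j := has_integralZ (A i j / 2)
  (has_integralB (HS (e i + e j)) (has_integralD (HS (e i)) (HS (e j)))).
have Hi i := has_integral_sum (index_enum 'I_K.+1) (P := predT) (fun j _ => Hij i j).
have := has_integral_sum (index_enum 'I_K.+1) (P := predT) (fun i _ => Hi i).
set w := (X in has_integral _ _ X) => H; exists w.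
apply: has_integral_ext H => z.
have de i v : dot (e i) v = v i 0.
  rewrite dotE (bigD1 i)//= mxE !eqxx mul1r big1 ?addr0// => j ji.
  by rewrite mxE (negbTE ji) mul0r.
rewrite quadE dotE !mulr_sumr; apply: eq_bigr => i _.
rewrite [(A *m _) i 0]mxE !mulr_sumr; apply: eq_bigr => j _.
by rewrite !dotDl !de !mxE; field.
Qed.

(** Log-density expanded in ln tau, tau and tau times a quadratic form, the statistics whose
    integrability is available. *)
Definition ln_ng_prior mu (L0 : 'M[R]_K.+1) (c1 d1 : R) z : R :=
  ln (d1 `^ c1 / Gamma c1) - ln (Num.sqrt (2 * pi) ^+ K.+1) + ln (\det L0) / 2
  + (K.+1%:R / 2 + c1 - 1) * ln z.2 - d1 * z.2
  - 2^-1 * (z.2 * quad L0 (colt z.1 - mu)).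

Lemma ln_normal_gamma_pdf mu L0 c1 d1 z : sym_posdef L0 -> 0 < c1 -> 0 < d1 ->
  0 < z.2 -> 0 < normal_gamma_pdf mu L0 c1 d1 (colt z.1) z.2 /\
  ln (normal_gamma_pdf mu L0 c1 d1 (colt z.1) z.2) = ln_ng_prior mu L0 c1 d1 z.
Proof.
move=> pL0 c10 d10 z0.
rewrite /normal_gamma_pdf mvnormal_pdfE; last exact: posdefZ.
have dL := det_posdef_gt0 pL0.
have k0 := mvgauss_const_gt0 (z.2 *: L0).
have g0 : 0 < d1 `^ c1 / Gamma c1 by rewrite divr_gt0 ?powR_gt0// Gamma_gt0.
have s0 : 0 < Num.sqrt (2 * pi) ^+ K.+1 :> R.
  by rewrite exprn_gt0// sqrtr_gt0 mulr_gt0 ?pi_gt0.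
have gp : 0 < gamma_pdf c1 d1 z.2.
  by rewrite /gamma_pdf mulr_gt0 ?expR_gt0// mulr_gt0 ?powR_gt0.
have mp : 0 < (mvgauss_const (z.2 *: L0))^-1 * mvgauss (z.2 *: L0) mu (colt z.1).
  by rewrite mulr_gt0 ?invr_gt0 ?expR_gt0.
split; first exact: mulr_gt0.
rewrite lnM ?posrE// lnM ?posrE ?invr_gt0 ?expR_gt0// lnV ?posrE//.
rewrite /mvgauss expRK quadZ /mvgauss_const lnM ?posrE ?expR_gt0// expRK.
rewrite detZ lnM ?posrE ?exprn_gt0// [ln (z.2 ^+ _)]lnXn//.
rewrite /gamma_pdf lnM ?posrE ?(mulr_gt0 g0) ?expR_gt0 ?powR_gt0//.
rewrite lnM ?posrE ?powR_gt0// ln_powR expRK.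
rewrite /ln_ng_prior -(mulr_natl (ln z.2)); by field.
Qed.

Lemma has_integral_ng_prior mu L0 c1 d1 :
  exists v, leaf_integral (fun z => ng z * ln_ng_prior mu L0 c1 d1 z) v.
Proof.
have [v Hq] := has_integral_ng_quad L0 mu.
pose k0 := ln (d1 `^ c1 / Gamma c1) - ln (Num.sqrt (2 * pi) ^+ K.+1) + ln (\det L0) / 2.
have := has_integralB (has_integralB (has_integralD (has_integralZ k0 has_integral_ng1)
   (has_integralZ (K.+1%:R / 2 + c1 - 1) has_integral_ng_ln))
   (has_integralZ d1 has_integral_ng_tau)) (has_integralZ 2^-1 Hq).
set w := (X in has_integral _ _ X) => H; exists w.
by apply: has_integral_ext H => z; rewrite /ln_ng_prior -/k0; ring.
Qed.

Lemma measurable_ln_ng_prior mu L0 c1 d1 :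
  measurable_fun setT (ln_ng_prior mu L0 c1 d1).
Proof.
apply: measurable_funB.
  apply: measurable_funB; last by apply: measurable_funM => //; exact: measurable_snd.
  apply: measurable_funD => //; apply: measurable_funM => //.
  by apply: (measurableT_comp (@measurable_ln R)); exact: measurable_snd.
apply: measurable_funM => //; apply: measurable_funM; first exact: measurable_snd.
by apply: measurable_quad => i; apply: measurable_coltB; exact: measurable_fst.
Qed.

Definition ln_obs h y z : R :=
  2^-1 * (- ln (2 * pi) + ln z.2 - z.2 * (y - dot h (colt z.1)) ^+ 2).

Lemma ln_normal_pdf h y z : 0 < z.2 ->
  0 < normal_pdf (dot h (colt z.1)) (Num.sqrt z.2^-1) y /\
  ln (normal_pdf (dot h (colt z.1)) (Num.sqrt z.2^-1) y) = ln_obs h y z.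
Proof.
move=> z0; have s0 : Num.sqrt z.2^-1 != 0 by rewrite gt_eqF// sqrtr_gt0 invr_gt0.
have s2 : Num.sqrt z.2^-1 ^+ 2 = z.2^-1 by rewrite sqr_sqrtr// invr_ge0 ltW.
rewrite normal_pdfE//; split; first by rewrite mulr_gt0 ?normal_peak_gt0 ?expR_gt0.
rewrite lnM ?posrE ?normal_peak_gt0 ?expR_gt0// /normal_fun expRK s2.
have w0 : 0 < z.2^-1 * pi *+ 2 by rewrite pmulrn_lgt0// mulr_gt0 ?invr_gt0 ?pi_gt0.
rewrite /normal_peak s2 lnV ?posrE ?sqrtr_gt0//.
have -> : ln (Num.sqrt (z.2^-1 * pi *+ 2)) = 2^-1 * ln (z.2^-1 * pi *+ 2).
  rewrite -{2}(sqr_sqrtr (ltW w0)) lnXn ?sqrtr_gt0// -(mulr_natl (ln _)) mulrA.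
  by rewrite mulVf// mul1r.
rewrite (_ : z.2^-1 * pi *+ 2 = z.2^-1 * (2 * pi)); last by rewrite -mulr_natl; ring.
rewrite lnM ?posrE ?invr_gt0 ?mulr_gt0 ?pi_gt0// lnV ?posrE// /ln_obs -mulr_natr.
by field; rewrite gt_eqF.
Qed.

(** At the parameters of q this value is [star] without the leaf probability. *)
Lemma has_integral_ng_obs h y :
  leaf_integral (fun z => ng z * ln_obs h y z)
    (2^-1 * (- ln (2 * pi) + digamma c - ln d - c / d * (y - dot h m) ^+ 2
      - quad (invmx L) h)).
Proof.
have := has_integralZ 2^-1 (has_integralB (has_integralD
  (has_integralZ (- ln (2 * pi)) has_integral_ng1) has_integral_ng_ln)
  (has_integral_ng_sqr m h y pL c0 d0)).
rewrite mulr1 (_ : _ + _ - (_ + _) = - ln (2 * pi) + digamma c - ln d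
  - c / d * (y - dot h m) ^+ 2 - quad (invmx L) h); last by ring.
by apply: has_integral_ext => z; rewrite /ln_obs; ring.
Qed.

Lemma measurable_ln_obs h y : measurable_fun setT (ln_obs h y).
Proof.
apply: measurable_funM => //; apply: measurable_funB.
  apply: measurable_funD => //.
  by apply: (measurableT_comp (@measurable_ln R)); exact: measurable_snd.
apply: measurable_funM; first exact: measurable_snd.
apply: measurable_funX; apply: measurable_funB => //.
by apply: measurable_dot => i; apply: measurable_colt; exact: measurable_fst.
Qed.

End NormalGammaLog.

(** * Random trees and paths *)

Section TreeCombinatorics.
Variables M D : nat.
Local Notation node := (node M D).
Local Notation troot := (Defs.root M D).
Implicit Types (s p : node) (m : 'I_M) (T : {set node}) (X : {ffun node -> bool}).

Lemma val_child s m : inner s -> child s m = rcons s m :> seq _.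
Proof. by rewrite /inner /child => sD; rewrite val_insubd size_rcons sD. Qed.

Lemma child_inj p p' m m' : inner p -> inner p' -> child p m = child p' m' ->
  p = p' /\ m = m'.
Proof.
move=> pi pi' /(congr1 val); rewrite /= !val_child// => /rcons_inj[pp ->].
by split => //; exact/val_inj.
Qed.

Lemma node_ind (P : node -> Prop) : P troot ->
  (forall p m, inner p -> P p -> P (child p m)) -> forall s, P s.
Proof.
move=> P0 PS [s]; elim/last_ind: s => [|s m IH] sD.
  by rewrite (_ : Bseq sD = troot)//; exact/val_inj.
have sD' : (size s <= D)%N by rewrite ltnW// -(size_rcons s m).
have pi : inner (Bseq sD') by rewrite /inner/= -(size_rcons s m).
rewrite (_ : Bseq sD = child (Bseq sD') m); first exact/PS.
by apply/val_inj; rewrite /= val_child.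
Qed.

Lemma anc_refl s : anc s s. Proof. exact: prefix_refl. Qed.

Lemma anc_trans s2 s1 s3 : anc s1 s2 -> anc s2 s3 -> anc s1 s3.
Proof. exact: prefix_trans. Qed.

Lemma anc_eq s1 s2 : anc s1 s2 -> size s1 = size s2 -> s1 = s2.
Proof. by rewrite /anc prefixE => /eqP e s12; apply/val_inj; rewrite /= -e s12 take_size. Qed.

Lemma sancE s1 s2 : sanc s1 s2 = anc s1 s2 && (size s1 < size s2)%N.
Proof.
rewrite /sanc; case: (boolP (anc s1 s2)) => //= s12.
have := size_prefix s12; rewrite leq_eqVlt => /predU1P[e|lt].
  by rewrite (anc_eq s12 e) eqxx ltnn.
by rewrite lt; apply/eqP => e; rewrite e ltnn in lt.
Qed.

Lemma sanc_root s : sanc s troot = false.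
Proof. by rewrite sancE ltn0 andbF. Qed.

Lemma anc_child s p m : inner p -> anc s (child p m) = (s == child p m) || anc s p.
Proof.
move=> pi; apply/idP/idP; last first.
  case/orP => [/eqP->|sp]; first exact: anc_refl.
  by apply: anc_trans sp _; rewrite /anc val_child// prefix_rcons.
rewrite /anc val_child// => sc; have := size_prefix sc; rewrite size_rcons.
rewrite leq_eqVlt => /predU1P[e|lt].
  by rewrite (@anc_eq s (child p m)) ?eqxx ?size_child// /anc val_child.
move: sc; rewrite prefixE -cats1 takel_cat; last by rewrite -ltnS.
by rewrite -prefixE => ->; rewrite orbT.
Qed.

Lemma sanc_child s p m : inner p -> sanc s (child p m) = anc s p.
Proof.
move=> pi; rewrite /sanc anc_child//; case: eqP => //= [->|_]; last by rewrite andbT.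
apply/esym/negbTE/negP => /size_prefix.
by rewrite size_child// ltnn.
Qed.

(** [X s] is the decision to branch at [s]. Decisions exist at every node, even where the tree never
    gets, so that they can be independent; those outside the tree have no effect on it. *)
Definition branching_tree X : {set node} := [set s | [forall s', sanc s' s ==> X s']].

Lemma in_branching_tree X s :
  reflect (forall s', sanc s' s -> X s') (s \in branching_tree X).
Proof.
rewrite inE; apply: (iffP forallP) => H s'; first by apply/implyP.
by apply/implyP; exact: H.
Qed.

Lemma branching_tree_child X s m : inner s ->
  (child s m \in branching_tree X) = (s \in branching_tree X) && X s.
Proof.
move=> si; apply/in_branching_tree/andP => [H|[/in_branching_tree H Xs] s'].
  split; last by apply: H; rewrite sanc_child ?anc_refl.
  apply/in_branching_tree => s' ss'; apply: H; rewrite sanc_child//.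
  by case/andP: ss'.
rewrite sanc_child// => ss'; case: (eqVneq s' s) => [->//|s's].
by apply: H; rewrite /sanc ss'.
Qed.

Hypothesis M_gt0 : (0 < M)%N.

(** A node set shows a branching only through a child; [M_gt0] provides the child that witnesses
    [X s]. *)
Lemma inner_nodesE X s :
  (s \in inner_nodes (branching_tree X)) = [&& s \in branching_tree X, inner s & X s].
Proof.
rewrite inE; case: (boolP (s \in branching_tree X)) => //= sT.
case: (boolP (inner s)) => //= si; apply/existsP/idP => [[m]|Xs].
  by rewrite branching_tree_child// => /andP[].
by exists (Ordinal M_gt0); rewrite branching_tree_child// sT.
Qed.

Lemma leavesE X s :
  (s \in leaves (branching_tree X)) = (s \in branching_tree X) && ~~ (inner s && X s).
Proof.
rewrite finset.in_setD inner_nodesE negb_and.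
by case: (s \in branching_tree X); rewrite ?andbT ?andbF.
Qed.

Lemma regular_branching_tree X : regular_subtree (branching_tree X).
Proof.
apply/and3P; split.
- by apply/in_branching_tree => s; rewrite sanc_root.
- apply/forall_inP => s /in_branching_tree sT; apply/forall_inP => s' s's.
  apply/in_branching_tree => s''; rewrite sancE => /andP[s''s' lt].
  apply: sT; rewrite sancE (anc_trans s''s' s's)/=.
  by rewrite (leq_trans lt)// size_prefix.
- apply/forall_inP => s sT; apply/implyP => si.
  case: (boolP (X s)) => Xs; apply/orP; [left|right]; apply/forallP => m.
    by rewrite branching_tree_child// sT.
  by rewrite branching_tree_child// sT.
Qed.

(** The fibre of [branching_tree] over [T] is a cylinder: branch at the inner nodes of [T], stop at
    its leaves of depth less than [D], anything elsewhere. Membership is compared from the root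
    downwards. *)
Lemma branching_tree_eq X T : regular_subtree T ->
  (branching_tree X == T) = [forall s, ((s \in inner_nodes T) ==> X s) &&
    ((s \in leaves T) && inner s ==> ~~ X s)].
Proof.
move=> /and3P[rT /forall_inP cT /forall_inP bT]; apply/eqP/forallP.
  move=> <- s; rewrite inner_nodesE leavesE.
  case: (s \in _) => //=; case: (inner s) => /=; rewrite ?andbF//.
  by rewrite implybb/= andbT implybb.
move=> H; apply/finset.setP; apply: node_ind => [|p m pi IH].
  by rewrite rT; apply/in_branching_tree => s; rewrite sanc_root.
rewrite branching_tree_child// IH; apply/andP/idP.
  (* The decision [X p] keeps [p] from being a leaf of [T], so [T] contains some child of [p] and,
     by regularity, all of them. *)
  case=> pT Xp; have /andP[_] := H p; rewrite pi andbT Xp/= => /implyP pL.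
  have : p \in inner_nodes T.
    by apply/negPn/negP => pI; have := pL _; rewrite finset.in_setD pI pT => /(_ isT).
  rewrite inE => /and3P[_ _ /existsP[m' m'T]].
  have := bT p pT; rewrite pi/= => /orP[/forallP//|/forallP/(_ m')].
  by rewrite m'T.
move=> cpT; have pT : p \in T.
  have /forallP/(_ p)/implyP := cT _ cpT; apply.
  by rewrite anc_child// anc_refl orbT.
split => //; have /andP[/implyP + _] := H p; apply.
by rewrite inE pT pi; apply/existsP; exists m.
Qed.

Variable R : realType.
Variable h : node -> R.
Hypothesis h0 : forall s, ~~ inner s -> h s = 0.

Definition branching_pmf X : R := \prod_s (if X s then h s else 1 - h s).

Lemma branching_pmf_neq0 X s : branching_pmf X != 0 -> X s -> inner s.
Proof.
move=> X0 Xs; apply: contraNT X0 => si.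
by rewrite /branching_pmf (bigD1 s)//= Xs h0// mul0r.
Qed.

(** The probability of a cylinder event: a node outside [A] and [C] contributes
    [h s + (1 - h s) = 1]. *)
Lemma sum_branching_pmf (A C : {set node}) : [disjoint A & C] ->
  \sum_(X : {ffun node -> bool} |
      [forall s, ((s \in A) ==> X s) && ((s \in C) ==> ~~ X s)]) branching_pmf X
  = (\prod_(s in A) h s) * \prod_(s in C) (1 - h s).
Proof.
(* [G] gives weight 0 to each forbidden decision, so the constrained sum becomes a free one, which
   factors over the nodes. *)
move=> AC; pose G s (c : bool) : R :=
  if s \in A then (if c then h s else 0) else
  if s \in C then (if c then 0 else 1 - h s) else if c then h s else 1 - h s.
have GA : \sum_(X : {ffun node -> bool}) \prod_s G s (X s) =
    (\prod_(s in A) h s) * \prod_(s in C) (1 - h s).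
  rewrite -(bigA_distr_bigA G).
  rewrite [X in _ = X * _]big_mkcond [X in _ = _ * X]big_mkcond -big_split/=.
  apply: eq_bigr => s _; rewrite big_bool /G.
  case: (boolP (s \in A)) => sA; last first.
    by case: ifP => _ /=; ring.
  by rewrite (disjointFr AC sA) /= addr0 mulr1.
rewrite -GA [LHS]big_mkcond; apply: eq_bigr => X _.
case: ifPn => [/forallP H|].
  apply: eq_bigr => s _; rewrite /G; have /andP[/implyP HA /implyP HC] := H s.
  have [sA|_] := boolP (s \in A); first by rewrite HA.
  by have [sC|//] := boolP (s \in C); rewrite (negbTE (HC sC)).
rewrite negb_forall => /existsP[s]; rewrite negb_and !negb_imply andbT => H.
rewrite (bigD1 s)//= /G; case/orP: H => /andP[sAC]; last first.
  by move=> ->; rewrite (disjointFl AC sAC) sAC mul0r.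
by move=> /negbTE->; rewrite sAC mul0r.
Qed.

Lemma sum_tree_pmf_branching (F : {set node} -> R) :
  \sum_(T : {set node} | regular_subtree T) tree_pmf h T * F T =
  \sum_(X : {ffun node -> bool}) branching_pmf X * F (branching_tree X).
Proof.
rewrite [RHS](partition_big branching_tree (@regular_subtree M D))/=; last first.
  by move=> X _; exact: regular_branching_tree.
apply: eq_bigr => T rT.
transitivity (\sum_(X : {ffun node -> bool} | branching_tree X == T)
  branching_pmf X * F T); last by apply: eq_bigr => X /eqP->.
rewrite -mulr_suml; congr (_ * _).
rewrite /tree_pmf -sum_branching_pmf; last first.
  rewrite finset.disjoints_subset; apply/fintype.subsetP => s sI.
  by rewrite finset.in_setC finset.in_setD sI.
rewrite [LHS]big_mkcond [RHS]big_mkcond; apply: eq_bigr => X _.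
have [X0|X0] := eqVneq (branching_pmf X) 0; first by rewrite X0 !if_same.
rewrite branching_tree_eq//.
congr (if _ then _ else _); apply: eq_forallb => s; congr (_ && _).
(* The product in [tree_pmf] also fixes the decision at leaves of depth [D], which the fibre leaves
   free; an [X] of nonzero weight never branches there, so the two conditions agree. *)
case: (boolP (inner s)) => si; first by rewrite andbT.
rewrite andbF/= (_ : X s = false) ?implybT//.
by apply/negbTE/negP => /(branching_pmf_neq0 X0); exact/negP.
Qed.

Lemma sum_tree_pmf : \sum_(T : {set node} | regular_subtree T) tree_pmf h T = 1.
Proof.
have := sum_tree_pmf_branching (fun=> 1).
under eq_bigr do rewrite mulr1; move=> ->.
under eq_bigr do rewrite mulr1.
have := @sum_branching_pmf finset.set0 finset.set0.
rewrite !big_set0 mulr1 => <-; last by rewrite finset.disjoints_subset finset.sub0set.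
by apply: eq_bigl => X; apply/esym/forallP => s; rewrite !inE.
Qed.

(** Up to decision vectors of weight 0, [s] is a leaf exactly when all its strict ancestors branch
    and [s] does not, which is again a cylinder event. *)
Lemma sum_tree_pmf_leaf s :
  \sum_(T : {set node} | regular_subtree T) tree_pmf h T * (s \in leaves T)%:R =
  (1 - h s) * \prod_(s' | sanc s' s) h s'.
Proof.
rewrite sum_tree_pmf_branching.
have disj : [disjoint [set s' | sanc s' s]%SET & [set s]%SET].
  rewrite finset.disjoints_subset; apply/fintype.subsetP => s'.
  by rewrite !inE sancE => /andP[_]; apply: contraTneq => ->; rewrite ltnn.
have := sum_branching_pmf disj.
rewrite big_set1 mulrC; under [X in _ = _ * X]eq_bigl do rewrite inE.
move=> <-; rewrite [RHS]big_mkcond; apply: eq_bigr => X _.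
have [X0|X0] := eqVneq (branching_pmf X) 0; first by rewrite X0 mul0r if_same.
rewrite (_ : (s \in _) = [forall s', ((s' \in [set s' | sanc s' s]%SET) ==> X s') &&
  ((s' \in [set s]%SET) ==> ~~ X s')]).
  by case: ifP => _; rewrite ?mulr1 ?mulr0.
rewrite leavesE; apply/andP/forallP => [[/in_branching_tree sT sX] s'|H].
  rewrite !inE; apply/andP; split; apply/implyP; first exact: sT.
  move=> /eqP->.
  apply: contraNN sX => Xs; rewrite Xs andbT.
  exact: branching_pmf_neq0 X0 Xs.
split.
  apply/in_branching_tree => s' s's; have /andP[/implyP + _] := H s'.
  by rewrite inE; apply.
have /andP[_ /implyP] := H s; rewrite !inE eqxx => /(_ isT)/negbTE->.
by rewrite andbF.
Qed.

Lemma sum_tree_pmf_leaves (c : node -> R) :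
  \sum_(T : {set node} | regular_subtree T) tree_pmf h T * \sum_(s in leaves T) c s =
  \sum_s (1 - h s) * (\prod_(s' | sanc s' s) h s') * c s.
Proof.
under eq_bigr do rewrite big_mkcond mulr_sumr.
rewrite exchange_big; apply: eq_bigr => s _ /=.
rewrite -sum_tree_pmf_leaf mulr_suml; apply: eq_bigr => T _.
by case: ifP => _; rewrite ?(mulr1, mulr0, mul0r).
Qed.

End TreeCombinatorics.

(** * Products along a root-to-leaf path and sums over contexts *)

Section Paths.
Variables (R : realType) (M D : nat).
Hypotheses (M_gt0 : (0 < M)%N) (D_gt0 : (0 < D)%N).
Local Notation node := (node M D).
Local Notation troot := (Defs.root M D).
Local Notation m0 := (Ordinal M_gt0).
Implicit Types (s v : node) (m : 'I_M).

Definition ancestor v (d : nat) : node := insub_bseq D (take d v).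

Definition next v (d : nat) : 'I_M := nth m0 v d.

Lemma val_ancestor v d : ancestor v d = take d v :> seq _.
Proof.
rewrite /ancestor val_insubd ifT//; apply: leq_trans (size_bseq v).
by rewrite size_take_min geq_minr.
Qed.

Lemma size_ancestor v d : size v = D -> (d <= D)%N -> size (ancestor v d) = d.
Proof. by move=> vD dD; rewrite val_ancestor size_takel// vD. Qed.

Lemma ancestor0 v : ancestor v 0 = troot.
Proof. by apply/val_inj; rewrite /= val_ancestor take0. Qed.

Lemma inner_ancestor v d : size v = D -> (d < D)%N -> inner (ancestor v d).
Proof. by move=> vD dD; rewrite /inner size_ancestor// ltnW. Qed.

Lemma ancestorS v d : size v = D -> (d < D)%N ->
  ancestor v d.+1 = child (ancestor v d) (next v d).
Proof.
move=> vD dD; apply/val_inj; rewrite /= val_child ?inner_ancestor//.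
by rewrite !val_ancestor (take_nth m0) ?vD.
Qed.

Lemma ancE s v : anc s v = (s == ancestor v (size s)).
Proof.
rewrite /anc prefixE; apply/eqP/eqP => [e|->].
  by apply/val_inj; rewrite /= val_ancestor.
rewrite !val_ancestor; case: (leqP (size s) (size v)) => sv.
  by rewrite size_takel.
by rewrite !(take_oversize (ltnW sv)) take_size.
Qed.

Lemma anc_child_next s m v : size v = D -> inner s ->
  anc (child s m) v = anc s v && (m == next v (size s)).
Proof.
move=> vD si; have sD : (size s < D)%N by [].
rewrite !ancE size_child// ancestorS//; apply/eqP/andP => [|[/eqP<- /eqP<-]//].
by move=> /(child_inj si (inner_ancestor vD sD))[e1 e2]; rewrite -e1 -e2 !eqxx.
Qed.

(** An inner node on the path has exactly one child with exponent 1, a node off the path has none;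
    the surviving nodes are indexed by depth. *)
Lemma prod_child_path (F : node -> 'I_M -> R) v : size v = D ->
  \prod_(s | inner s) \prod_m F s m ^+ anc (child s m) v =
  \prod_(d < D) F (ancestor v d) (next v d).
Proof.
move=> vD.
transitivity (\prod_(s | inner s && anc s v) F s (next v (size s))).
  rewrite [RHS]big_mkcondr; apply: eq_bigr => s si.
  under eq_bigr do rewrite anc_child_next//.
  case: ifP => sv /=; last by rewrite big1.
  rewrite (bigD1 (next v (size s)))//= eqxx expr1 big1 ?mulr1// => m /negbTE->.
  by rewrite expr0.
(* The default [Ordinal D_gt0] is never reached: an inner node has size below [D]. *)
rewrite (reindex_onto (fun d : 'I_D => ancestor v d)
  (fun s => insubd (Ordinal D_gt0) (size s)))/=; last first.
  move=> s /andP[si]; rewrite ancE => /eqP {2}->; congr ancestor.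
  by rewrite val_insubd; case: ifP => //; rewrite -/(inner s) si.
have szE (d : 'I_D) : size (ancestor v d) = d by rewrite size_ancestor// ltnW.
apply: eq_big => [d|d _]; last by rewrite szE.
rewrite inner_ancestor// ancE szE eqxx/=; apply/eqP/val_inj.
by rewrite val_insubd ltn_ord.
Qed.

Lemma prod_anc_path (G : node -> R) v : size v = D ->
  \prod_(s | anc s v) G s = \prod_(d < D.+1) G (ancestor v d).
Proof.
move=> vD; rewrite (reindex_onto (fun d : 'I_D.+1 => ancestor v d)
  (fun s => inord (size s)))/=; last first.
  by move=> s; rewrite ancE => /eqP {2}->; rewrite inordK// ltnS size_bseq.
apply: eq_bigl => d; have szE : size (ancestor v d) = d.
  by rewrite size_ancestor// -ltnS.
by rewrite ancE szE eqxx inord_val eqxx.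
Qed.

(** Every node of the path but the root is the child of the preceding one; [G troot] supplies the
    missing factor. *)
Lemma prod_child_anc (G : node -> R) v : size v = D ->
  G troot * \prod_(s | inner s) \prod_m G (child s m) ^+ anc (child s m) v =
  \prod_(s | anc s v) G s.
Proof.
move=> vD; rewrite prod_child_path// prod_anc_path// big_ord_recl ancestor0.
by congr (_ * _); apply: eq_bigr => d _; rewrite -ancestorS.
Qed.

Lemma prod_inner_anc (G : node -> R) v : size v = D ->
  \prod_(s | inner s) \prod_(m < M) G s ^+ anc (child s m) v =
  \prod_(s | anc s v) (if inner s then G s else 1).
Proof.
move=> vD; rewrite prod_child_path// prod_anc_path// big_ord_recr/=.
rewrite [inner (ancestor v D)]/inner size_ancestor// ltnn mulr1.
by apply: eq_bigr => d _; rewrite inner_ancestor.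
Qed.

Definition tuple_ctx_matrix (t : D.-tuple 'I_M) : 'M[bool]_(D, M) :=
  \matrix_(d, m) (m == tnth t d).

Lemma one_hot_tuple_ctx t : one_hot_rows (tuple_ctx_matrix t).
Proof.
apply/forallP => d; apply/cards1P; exists (tnth t d).
by apply/finset.setP => m; rewrite !inE mxE.
Qed.

(** Contexts correspond to [D]-tuples of child indices, over which a sum splits coordinate by
    coordinate. *)
Definition tuple_ctx t : ctx M D := Sub _ (one_hot_tuple_ctx t).

Lemma val_tuple_ctx t d m : val (tuple_ctx t) d m = (m == tnth t d).
Proof. by rewrite SubK mxE. Qed.

Lemma ctx_leaf_tuple t : ctx_leaf (tuple_ctx t) = t :> seq _.
Proof.
have E : pmap (fun d : 'I_D => [pick m | val (tuple_ctx t) d m]) (enum 'I_D) = t.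
  transitivity (pmap (Some \o tnth t) (enum 'I_D)).
    apply: eq_pmap => d /=; case: pickP => [m|/(_ (tnth t d))].
      by rewrite val_tuple_ctx => /eqP->.
    by rewrite val_tuple_ctx eqxx.
  rewrite -[RHS]map_tnth_enum.
  by elim: (enum 'I_D) => //= d s ->.
by rewrite /ctx_leaf val_insubd E size_tuple leqnn.
Qed.

Lemma tuple_ctx_bij : bijective tuple_ctx.
Proof.
exists (fun u : ctx M D => [tuple odflt m0 [pick m | val u d m] | d < D]).
  move=> t; apply: eq_from_tnth => d; rewrite tnth_mktuple.
  case: pickP => [m|/(_ (tnth t d))]; rewrite val_tuple_ctx ?eqxx//.
  by move=> /eqP->.
move=> u; apply/val_inj/matrixP => d m; rewrite val_tuple_ctx tnth_mktuple.
have /cards1P[m1 /finset.setP um1] := forallP (valP u) d.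
have uE m' : val u d m' = (m' == m1) by have := um1 m'; rewrite !inE.
rewrite uE; case: pickP => [m'|/(_ m1)]; rewrite uE ?eqxx//.
by move=> /eqP->.
Qed.

(** The prefix [p] is the part of the path already chosen: once the next choice [m] is factored out,
    the rest is the same sum started from [rcons p m]. *)
Lemma sum_tuple_path (F : seq 'I_M -> 'I_M -> R) k p : (size p + k = D)%N ->
  (forall q, (size q < D)%N -> \sum_m F q m = 1) ->
  \sum_(t : k.-tuple 'I_M) \prod_(d < k) F (p ++ take d t) (nth m0 t d) = 1.
Proof.
move=> + F1; elim: k p => [|k IH] p pk.
  rewrite (big_pred1 [tuple]) ?big_ord0// => t.
  by apply/esym/eqP/val_inj; case: t => -[].
rewrite (reindex (fun z : 'I_M * k.-tuple 'I_M => [tuple of z.1 :: z.2])); last first.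
  exists (fun t => (thead t, [tuple of behead t])) => t _ /=.
    by case: t => m t /=; rewrite theadE; congr pair; exact/val_inj.
  by rewrite -tuple_eta.
under eq_bigr do rewrite big_ord_recl/= cats0.
under eq_bigr do under eq_bigr do rewrite -cat_rcons.
rewrite -(pair_bigA _ (fun m (t : k.-tuple 'I_M) =>
   F p m * \prod_(d < k) F (rcons p m ++ take d t) (nth m0 t d)))/=.
rewrite -[RHS](F1 p); last by rewrite -pk addnS ltnS leq_addr.
apply: eq_bigr => m _; rewrite -mulr_sumr IH ?mulr1//.
by rewrite size_rcons addSn -addnS.
Qed.

Lemma sum_ctx_path (F : node -> 'I_M -> R) :
  (forall s, inner s -> \sum_m F s m = 1) ->
  \sum_(u : ctx M D) \prod_(s | inner s) \prod_m
     F s m ^+ anc (child s m) (ctx_leaf u) = 1.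
Proof.
move=> F1; under eq_bigr do rewrite (prod_child_path _ (size_ctx_leaf _)).
rewrite (reindex tuple_ctx); last exact/onW_bij/tuple_ctx_bij.
have F1' (q : seq 'I_M) : (size q < D)%N -> \sum_m F (insub_bseq D q) m = 1.
  by move=> qD; apply: F1; rewrite /inner val_insubd; case: ifP.
rewrite -[RHS](sum_tuple_path (k := D) (p := [::]) (add0n D) F1').
apply: eq_bigr => t _; apply: eq_bigr => d _.
by rewrite /next /ancestor ctx_leaf_tuple.
Qed.

End Paths.

(** * The variational update *)

Section ModelFacts.
Variables (R : realType) (M D J K n : nat).
Variable B : softBCT R M D J K n.
Variable piv : 'I_n -> node M D -> 'I_M -> R.
Hypothesis piv_ge0 : forall t s m, inner s -> 0 <= piv t s m.
Implicit Types s : node M D.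
Local Notation Lambda' := (Lambda' B piv).
Local Notation mu' := (mu' B piv).
Local Notation a' := (a' B piv).
Local Notation b' := (b' B piv).
Local Notation phi := (phi B piv).
Local Notation g' := (g' B piv).

Lemma reach_ge0 s t : 0 <= reach piv s t.
Proof. by apply: prodr_ge0 => s' si; apply: prodr_ge0 => m _; exact: piv_ge0. Qed.

Lemma quad_diag_mx d (r : 'rV[R]_d) v : quad (diag_mx r) v = \sum_i r 0 i * v i 0 ^+ 2.
Proof.
rewrite quadE dotE; apply: eq_bigr => i _.
by rewrite mul_diag_mx mxE mulrCA expr2.
Qed.

Lemma quad_Q_ge0 s v : 0 <= quad (Q piv s) v.
Proof.
rewrite quad_diag_mx sumr_ge0// => t _; rewrite mxE.
by rewrite mulr_ge0 ?sqr_ge0// reach_ge0.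
Qed.

Lemma quad_Lambda' s v : quad (Lambda' s) v =
  quad (Lambda B) v + quad (Q piv s) (XA B *m v).
Proof.
by rewrite !quadE mulmxDl dotDr -2!mulmxA -dot_tr.
Qed.

Lemma Lambda'_posdef s : sym_posdef (Lambda' s).
Proof.
have [sL pL] := Lambda_sym_posdef B; split.
  by rewrite linearD/= sL !trmx_mul trmxK tr_diag_mx mulmxA.
by move=> v v0; rewrite quad_Lambda' ltr_wpDr ?quad_Q_ge0 ?pL.
Qed.

Lemma a'_gt0 s : 0 < a' s.
Proof.
rewrite ltr_wpDr ?a_gt0// divr_ge0// mxtrace_diag sumr_ge0// => t _.
by rewrite mxE reach_ge0.
Qed.

(** Completing the square: the bracket is the regularised least-squares criterion at its minimiser
    [mu'], a sum of two nonnegative quadratic forms. *)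
Lemma b'_gt0 s : 0 < b' s.
Proof.
rewrite ltr_wpDr ?b_gt0// divr_ge0//.
have [sL pL] := Lambda_sym_posdef B.
have muE : Lambda' s *m mu' s = Lambda B *m mu B + (XA B)^T *m Q piv s *m x B.
  by rewrite /mu' mulmxA mulmxV ?mul1mx// posdef_unit//; exact: Lambda'_posdef.
have L1 : 0 <= quad (Lambda B) (mu B - mu' s).
  by have [->|/pL/ltW//] := eqVneq (mu B - mu' s) 0; rewrite quadE mulmx0 dot0r.
have Q1 := quad_Q_ge0 s (x B - XA B *m mu' s).
suff -> : quad (Lambda B) (mu B) + quad (Q piv s) (x B) - quad (Lambda' s) (mu' s)
   = quad (Lambda B) (mu B - mu' s) + quad (Q piv s) (x B - XA B *m mu' s).
  exact: addr_ge0.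
have E1 := quad_Lambda' s (mu' s).
(* The normal equations [muE], paired with [mu']. *)
have E2 : quad (Lambda' s) (mu' s) = dot (mu' s) (Lambda B *m mu B)
   + dot (XA B *m mu' s) (Q piv s *m x B).
  by rewrite quadE muE dotDr -mulmxA -[in RHS](trmxK (XA B)) dot_tr trmxK.
have quadB (d : nat) (A : 'M[R]_d) u v : A^T = A ->
    quad A (u - v) = quad A u - 2 * dot v (A *m u) + quad A v.
  move=> sA; rewrite !quadE mulmxBr !dotBr !dotBl.
  by rewrite (dotC u (A *m v)) dot_tr sA; ring.
rewrite !quadB ?tr_diag_mx//; lra.
Qed.

Lemma phi_gt0 s : 0 < phi s.
Proof.
rewrite /phi; move: (D - size s)%N => k; elim: k s => [|k IH] s /=; first exact: expR_gt0.
have /andP[g0 g1] := g_itv B s.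
have P0 : 0 < \prod_(m < M) phi_rec B piv k (child s m).
  by apply: prodr_gt0 => m _; exact: IH.
move: g0; rewrite le_eqVlt => /predU1P[<-|g0].
  by rewrite mul0r addr0 subr0 mul1r expR_gt0.
by rewrite ltr_wpDl ?mulr_gt0// mulr_ge0 ?subr_ge0// expR_ge0.
Qed.

Lemma g'_leaf s : ~~ inner s -> g' s = 0.
Proof. by rewrite /g' => /negbTE->. Qed.

Lemma g'_eq0 s : g B s = 0 -> g' s = 0.
Proof. by rewrite /g' => ->; rewrite !mul0r if_same. Qed.

Lemma g'_eq1 s : g B s = 1 -> g' s = 1.
Proof.
move=> g1; rewrite /g'; case: ifPn => si; last first.
  by have := g_leaf B si; rewrite g1 => /eqP; rewrite oner_eq0.
rewrite (phi_inner B piv si) g1 subrr mul0r add0r mul1r divff//.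
by have := phi_gt0 s; rewrite (phi_inner B piv si) g1 subrr mul0r add0r mul1r => /gt_eqF->.
Qed.

(** A vanishing prior factor means [g = 0] at an inner node or [g = 1] at a leaf, and [g'] inherits
    both values. Hence the logarithm of 0 never meets a tree of nonzero weight. *)
Lemma tree_pmf_gt0 T : tree_pmf g' T != 0 -> 0 < tree_pmf (g B) T.
Proof.
move=> T0; rewrite lt0r; apply/andP; split; last first.
  apply: mulr_ge0; apply: prodr_ge0 => s _; have /andP[? ?] := g_itv B s => //.
  by rewrite subr_ge0.
apply: contra_neq T0 => /eqP; rewrite /tree_pmf mulf_eq0 => /orP[]/prodf_eq0[s sT /eqP gs].
  by rewrite (bigD1 s)//= g'_eq0// !mul0r.
rewrite [X in _ * X](bigD1 s)//= g'_eq1 ?subrr ?mul0r ?mulr0//.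
by apply/eqP; rewrite eq_sym -subr_eq0 gs.
Qed.

End ModelFacts.

(** * The expected log-joint density for a fixed tree *)

Section Expectation.
Variables (R : realType) (M D J K n : nat).
Variable B : softBCT R M D J K n.
Variable piv : 'I_n -> node M D -> 'I_M -> R.
Hypothesis piv_ge0 : forall t s m, inner s -> 0 <= piv t s m.
Implicit Types (s : node M D) (T : {set node M D}) (U : {ffun 'I_n -> ctx M D}).
Local Notation Lambda' := (Lambda' B piv).
Local Notation mu' := (mu' B piv).
Local Notation a' := (a' B piv).
Local Notation b' := (b' B piv).
Local Notation g' := (g' B piv).

Lemma ln_prod (I : Type) (r : seq I) (P : pred I) (f : I -> R) :
  (forall i, P i -> 0 < f i) ->
  0 < \prod_(i <- r | P i) f i /\
  ln (\prod_(i <- r | P i) f i) = \sum_(i <- r | P i) ln (f i).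
Proof.
move=> f0; have p0 : 0 < \prod_(i <- r | P i) f i by exact: prodr_gt0.
split => //; elim: r {p0} => [|i r IH]; first by rewrite !big_nil ln1.
rewrite !big_cons; case: ifP => // Pi.
by rewrite lnM ?posrE ?f0 ?prodr_gt0// IH.
Qed.

Lemma ln_expb (r : R) (c : bool) : ln (r ^+ c) = c%:R * ln r.
Proof. by case: c; rewrite ?expr1 ?mul1r// expr0 ln1 mul0r. Qed.

Lemma softmax_gt0 (v : 'cV[R]_M) m : 0 < softmax v m.
Proof.
by rewrite divr_gt0 ?expR_gt0// (bigD1 m)//= ltr_pwDl ?expR_gt0// sumr_ge0.
Qed.

Lemma ctx_pmf_gt0 t u : 0 < ctx_pmf B t u.
Proof.
apply: prodr_gt0 => s _; apply: prodr_gt0 => m _.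
by rewrite exprn_gt0// softmax_gt0.
Qed.

Definition obs_expect (t : 'I_n) s : R :=
  2^-1 * (- ln (2 * pi) + digamma (a' s) - ln (b' s)
   - a' s / b' s * (x B t 0 - dot (xA B t) (mu' s)) ^+ 2
   - quad (invmx (Lambda' s)) (xA B t)).

Lemma starE t s : star B piv t s =
  (1 - g' s) * (\prod_(s' | sanc s' s) g' s') * obs_expect t s.
Proof. by rewrite /star /obs_expect; ring. Qed.

Definition leaf_log U s (z : leaf_param R K) : R :=
  ln_ng_prior (mu B) (Lambda B) (a B) (b B) z +
  \sum_t (anc s (ctx_leaf (U t)))%:R * ln_obs (xA B t) (x B t 0) z.

Lemma lne_joint_pdf U T (z : #|leaves T|.-tuple (leaf_param R K)) :
  0 < tree_pmf (g B) T -> (forall s, s \in leaves T -> 0 < tau_of z s) ->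
  lne (joint_pdf B U T (theta_of z) (tau_of z))%:E =
  (ln (tree_pmf (g B) T) + \sum_t ln (ctx_pmf B t (U t)) +
   \sum_(s in leaves T) leaf_log U s (leaf_coord z s))%:E.
Proof.
move=> T0 z0.
have [P0 PE] := @ln_prod _ (index_enum (node M D)) (mem (leaves T))
   (fun s => normal_gamma_pdf (mu B) (Lambda B) (a B) (b B) (theta_of z s) (tau_of z s))
   (fun s sT => (ln_normal_gamma_pdf (mu B) (Lambda_sym_posdef B) (a_gt0 B) (b_gt0 B)
      (z0 s sT)).1).
have obs t : 0 < obs_pdf B t (U t) T (theta_of z) (tau_of z) /\
  ln (obs_pdf B t (U t) T (theta_of z) (tau_of z)) = \sum_(s in leaves T)
    (anc s (ctx_leaf (U t)))%:R * ln_obs (xA B t) (x B t 0) (leaf_coord z s).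
  have [op0 opE] := @ln_prod _ (index_enum (node M D)) (mem (leaves T))
    (fun s => normal_pdf (dot (xA B t) (theta_of z s)) (Num.sqrt (tau_of z s)^-1) (x B t 0)
      ^+ anc s (ctx_leaf (U t)))
    (fun s sT => exprn_gt0 _ (ln_normal_pdf (xA B t) (x B t 0) (z0 s sT)).1).
  split; first exact: op0.
  rewrite [LHS]opE; apply: eq_bigr => s sT.
  by rewrite ln_expb (ln_normal_pdf (xA B t) (x B t 0) (z0 s sT)).2.
have [C0 CE] := @ln_prod _ (index_enum 'I_n) predT
  (fun t => ctx_pmf B t (U t) * obs_pdf B t (U t) T (theta_of z) (tau_of z))
  (fun t _ => mulr_gt0 (ctx_pmf_gt0 t (U t)) (obs t).1).
have TP0 := mulr_gt0 T0 P0.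
rewrite lne_EFin; last exact: mulr_gt0 TP0 C0.
rewrite [ln _](lnM TP0 C0) [ln (_ * param_pdf _ _ _ _)](lnM T0 P0) CE PE.
rewrite -[in RHS]addrA -addrA; congr (_ + _)%:E.
rewrite /leaf_log big_split/= addrCA; congr (_ + _).
  apply: eq_bigr => s sT.
  by rewrite (ln_normal_gamma_pdf (mu B) (Lambda_sym_posdef B) (a_gt0 B) (b_gt0 B)
      (z0 s sT)).2.
rewrite exchange_big/= -big_split/=; apply: eq_bigr => t _.
by have [pt pE] := obs t; rewrite lnM ?posrE ?ctx_pmf_gt0// pE.
Qed.

Lemma leaf_coord_enum_val T (z : #|leaves T|.-tuple (leaf_param R K)) i :
  leaf_coord z (enum_val i) = tnth z i.
Proof.
rewrite /leaf_coord (tnth_nth ([tuple of nseq K.+1 0], 0)); congr nth.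
by rewrite (enum_val_nth (Defs.root M D)) index_uniq ?enum_uniq// -cardE.
Qed.

(** [C] is quantified before [U] because it ends up in the additive constant of the optimality
    condition; it collects the log-prior of the tree and the expected log-priors of its leaves. *)
Lemma integral_tree T : 0 < tree_pmf (g B) T -> exists C : R, forall U,
  (\int[@tuple_measure _ _ _ (leaf_lebesgue R K) #|leaves T|]_(z in
        [set z | forall s, s \in leaves T -> (0 < tau_of z s)%R]%classic)
      ((qparam_pdf B piv T (theta_of z) (tau_of z))%:E
       * lne (joint_pdf B U T (theta_of z) (tau_of z))%:E)
  = (C + \sum_t (ln (ctx_pmf B t (U t)) +
     \sum_(s in leaves T) (anc s (ctx_leaf (U t)))%:R * obs_expect t s))%:E)%E.
Proof.
move=> T0.
pose ng s := ng_density (mu' s) (Lambda' s) (a' s) (b' s).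
have pL s := Lambda'_posdef B piv_ge0 s.
have a0 s := a'_gt0 B piv_ge0 s.
have b0 s := b'_gt0 B piv_ge0 s.
have HE0 s := has_integral_ng_prior (mu' s) (pL s) (a0 s) (b0 s)
  (mu B) (Lambda B) (a B) (b B).
have [E HE] := boolp.choice HE0.
exists (ln (tree_pmf (g B) T) + \sum_(s in leaves T) E s) => U.
pose v s := E s + \sum_t (anc s (ctx_leaf (U t)))%:R * obs_expect t s.
have Hv s : has_integral (leaf_lebesgue R K) (fun z => ng s z * leaf_log U s z) (v s).
  have := has_integralD (HE s) (has_integral_sum (index_enum 'I_n) (P := predT)
    (fun t _ => has_integralZ (anc s (ctx_leaf (U t)))%:R
      (has_integral_ng_obs (mu' s) (pL s) (a0 s) (b0 s) (xA B t) (x B t 0)))).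
  apply: has_integral_ext => z; rewrite /leaf_log [RHS]mulrDr mulr_sumr; congr (_ + _).
  by apply: eq_bigr => t _; rewrite mulrCA.
have mlog s : measurable_fun setT (leaf_log U s).
  apply: measurable_funD; first exact: measurable_ln_ng_prior.
  by apply: measurable_sum => t; apply: measurable_funM => //; exact: measurable_ln_obs.
pose k := #|leaves T|.
have [H1 H2] := @has_integral_tuple _ _ _ (leaf_lebesgue R K) k
  (fun i => ng (enum_val i)) (fun i => leaf_log U (enum_val i)) (fun i => v (enum_val i))
  (fun i => has_integral_ng1 _ (pL _) (a0 _) (b0 _)) (fun i => mlog _) (fun i => Hv _).
pose C0 := ln (tree_pmf (g B) T) + \sum_t ln (ctx_pmf B t (U t)).
have sumE (F : node M D -> R) : \sum_(i < k) F (enum_val i) = \sum_(s in leaves T) F s.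
  by rewrite [RHS]big_enum_val.
have HT := has_integralD (has_integralZ C0 H2) H1.
have -> : ln (tree_pmf (g B) T) + \sum_(s in leaves T) E s +
    \sum_t (ln (ctx_pmf B t (U t)) +
      \sum_(s in leaves T) (anc s (ctx_leaf (U t)))%:R * obs_expect t s) =
    C0 * 1 + \sum_(i < k) v (enum_val i).
  rewrite sumE mulr1 /v /C0 !big_split/= exchange_big/=; ring.
rewrite -HT.2 [LHS]integral_mkcond; apply: eq_integral => z _.
have prodE (F : node M D -> leaf_param R K -> R) :
    \prod_(s in leaves T) F s (leaf_coord z s) = \prod_(i < k) F (enum_val i) (tnth z i).
  by rewrite big_enum_val; apply: eq_bigr => i _; rewrite leaf_coord_enum_val.
have sumzE (F : node M D -> leaf_param R K -> R) :
    \sum_(s in leaves T) F s (leaf_coord z s) = \sum_(i < k) F (enum_val i) (tnth z i).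
  by rewrite big_enum_val; apply: eq_bigr => i _; rewrite leaf_coord_enum_val.
rewrite -(prodE ng) -(sumzE (leaf_log U)) patchE; case: ifPn => [|] zD.
  have z0 : forall s, s \in leaves T -> 0 < tau_of z s by move: zD; rewrite inE.
  rewrite lne_joint_pdf// -EFinM; congr EFin.
  have -> : qparam_pdf B piv T (theta_of z) (tau_of z) =
      \prod_(s in leaves T) ng s (leaf_coord z s).
    apply: eq_bigr => s sT; rewrite /ng ng_densityE//.
    by have := z0 s sT; rewrite /tau_of => ->.
  by rewrite -/C0; ring.
have [s sT zs] : exists2 s, s \in leaves T & tau_of z s <= 0.
  apply/not_exists2P => H; move/negP: zD; apply; rewrite inE /= => s sT.
  by have := H s; rewrite leNgt; case: (0 < _) => // -[].
rewrite (bigD1 s sT)/= {1 3}/ng ng_densityE// ltNge zs/= !mul0r.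
by rewrite mulr0 addr0.
Qed.

End Expectation.

(** * Marginals of a product law *)

Section ProductPmf.
Variables (R : realType) (n : nat) (C : finType) (w : 'I_n -> C -> R).
Hypothesis w1 : forall t, \sum_u w t u = 1.

Lemma sum_prod_ffun : \sum_(U : {ffun 'I_n -> C}) \prod_t w t (U t) = 1.
Proof. by rewrite -(bigA_distr_bigA w) big1. Qed.

Lemma sum_prod_ffun_at t u :
  \sum_(U : {ffun 'I_n -> C} | U t == u) \prod_t' w t' (U t') = w t u.
Proof.
(* [f] keeps only the value [u] at coordinate [t], so the constraint on [U] moves into the
   factors. *)
pose f t' v := w t' v * ((t' == t) ==> (v == u))%:R.
transitivity (\sum_(U : {ffun 'I_n -> C}) \prod_t' f t' (U t')).
  rewrite big_mkcond; apply: eq_bigr => U _; case: ifPn => Ut.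
    apply: eq_bigr => t' _; rewrite /f; case: eqP => [->|_]; last by rewrite mulr1.
    by rewrite Ut mulr1.
  by rewrite (bigD1 t)//= /f eqxx (negbTE Ut) mulr0 mul0r.
have ft' t' : t' != t -> \sum_v f t' v = 1.
  move=> /negbTE t't; rewrite -[RHS](w1 t'); apply: eq_bigr => v _.
  by rewrite /f t't mulr1.
have ft : \sum_v f t v = w t u.
  rewrite (bigD1 u)//= /f !eqxx mulr1 big1 ?addr0// => v /negbTE vu.
  by rewrite vu mulr0.
by rewrite -(bigA_distr_bigA f) (bigD1 t)//= [X in _ * X]big1 ?[LHS]mulr1.
Qed.

End ProductPmf.

(** * Normalisation and characterisation of the optimum *)

Section Optimum.
Variables (R : realType) (M D J K n : nat).
Variable B : softBCT R M D J K n.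
Variable piv : 'I_n -> node M D -> 'I_M -> R.
Hypothesis piv_ge0 : forall t s m, inner s -> 0 <= piv t s m.
Hypotheses (M_gt0 : (0 < M)%N) (D_gt0 : (0 < D)%N).
Implicit Types (s : node M D) (T : {set node M D}) (U : {ffun 'I_n -> ctx M D}).
Local Notation troot := (Defs.root M D).

Lemma expect_q_joint : exists C : R, forall U,
  expect_q B piv (fun T theta tau => lne (joint_pdf B U T theta tau)%:E) =
  (C + \sum_t (ln (ctx_pmf B t (U t)) +
               \sum_(s | anc s (ctx_leaf (U t))) star B piv t s))%:E.
Proof.
pose S U T := \sum_t (ln (ctx_pmf B t (U t)) +
  \sum_(s in leaves T) (anc s (ctx_leaf (U t)))%:R * obs_expect B piv t s).
have HC T : exists C : R, forall U, tree_pmf (g' B piv) T != 0 ->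
  (\int[@tuple_measure _ _ _ (leaf_lebesgue R K) #|leaves T|]_(z in
        [set z | forall s, s \in leaves T -> (0 < tau_of z s)%R]%classic)
      ((qparam_pdf B piv T (theta_of z) (tau_of z))%:E
       * lne (joint_pdf B U T (theta_of z) (tau_of z))%:E) = (C + S U T)%:E)%E.
  (* For a tree of weight 0 the integral may be [-oo], which no real [C] describes; the value 0 is
     arbitrary, as the weight annihilates the term. *)
  have [T0|T0] := eqVneq (tree_pmf (g' B piv) T) 0; first by exists 0.
  have [C HC] := integral_tree piv_ge0 (tree_pmf_gt0 T0).
  by exists C => U _; exact: HC.
have [C CE] := boolp.choice HC.
exists (\sum_(T | regular_subtree T) tree_pmf (g' B piv) T * C T) => U.
transitivity (\sum_(T | regular_subtree T) (tree_pmf (g' B piv) T * (C T + S U T))%:E)%E.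
  apply: eq_bigr => T _; have [T0|T0] := eqVneq (tree_pmf (g' B piv) T) 0.
    by rewrite T0 mul0e mul0r.
  by rewrite CE// EFinM.
rewrite sumEFin; congr EFin.
under eq_bigr do rewrite mulrDr; rewrite big_split/=; congr (_ + _).
rewrite /S; under eq_bigr do rewrite mulr_sumr.
rewrite exchange_big/=; apply: eq_bigr => t _.
under eq_bigr do rewrite mulrDr; rewrite big_split/=; congr (_ + _).
  by rewrite -mulr_suml (sum_tree_pmf M_gt0 (g'_leaf B piv)) mul1r.
rewrite (sum_tree_pmf_leaves M_gt0 (g'_leaf B piv)) [RHS]big_mkcond.
apply: eq_bigr => s _; rewrite starE.
by case: (anc s _); rewrite ?mul1r ?mul0r ?mulr0.
Qed.

Definition rho_sum t s : R := \sum_(m < M) rho B piv t s m.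

Lemma rho_sum_gt0 t s : 0 < rho_sum t s.
Proof.
by rewrite /rho_sum (bigD1 (Ordinal M_gt0))//= ltr_pwDl ?rho_gt0// sumr_ge0// => m _;
  rewrite ltW// rho_gt0.
Qed.

Lemma sum_pi' t s : \sum_m pi' B piv t s m = 1.
Proof. by rewrite -mulr_suml divff// gt_eqF// (rho_sum_gt0 t s). Qed.

(** Total weight of all continuations of a path below [s], including the term of [s] itself: the
    upward message of the sum-product algorithm. *)
Definition message t s : R :=
  expR (star B piv t s) * (if inner s then rho_sum t s else 1).

Lemma message_gt0 t s : 0 < message t s.
Proof. by rewrite mulr_gt0 ?expR_gt0//; case: ifP => // _; exact: rho_sum_gt0. Qed.

Lemma rhoE t s m : inner s ->
  rho B piv t s m = softmax (W B s *m xL B t) m * message t (child s m).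
Proof.
move=> si; rewrite -[LHS]lnK ?posrE ?rho_gt0// /message.
have s0 := softmax_gt0 (W B s *m xL B t) m.
have [ci|ci] := boolP (inner (child s m)).
  by rewrite (ln_rho_inner B piv t si ci) !expRD !lnK ?posrE// ?mulrA// rho_sum_gt0.
by rewrite (ln_rho_leaf B piv t si ci) expRD lnK ?posrE// mulr1.
Qed.

Definition ctx_optimum t (u : ctx M D) : R :=
  \prod_(s : node M D | inner s) \prod_(m < M)
    pi' B piv t s m ^+ anc (child s m) (ctx_leaf u).

(* Telescoping along the path: every normalizer cancels except the root's. *)
Lemma ctx_optimumE t u : ctx_pmf B t u * expR (\sum_(s | anc s (ctx_leaf u)) star B piv t s)
  = message t troot * ctx_optimum t u.
Proof.
have uD := size_ctx_leaf u.
have -> : ctx_optimum t u = ctx_pmf B t u *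
    (\prod_(s | inner s) \prod_m message t (child s m) ^+ anc (child s m) (ctx_leaf u)) *
    (\prod_(s | inner s) \prod_(m < M) rho_sum t s ^+ anc (child s m) (ctx_leaf u))^-1.
  rewrite -!prodfV -!big_split; apply: eq_bigr => s si /=.
  rewrite -prodfV -!big_split; apply: eq_bigr => m _ /=.
  by rewrite -exprVn -!exprMn /pi' rhoE.
rewrite mulrA [message _ _ * _]mulrCA (prod_child_anc M_gt0 D_gt0)//.
rewrite (prod_inner_anc M_gt0 D_gt0)// /message big_split/= -expR_sum mulrA mulfK//.
by apply/prodf_neq0 => s _; case: ifP => // _; rewrite gt_eqF// rho_sum_gt0.
Qed.

Lemma ctx_optimum_gt0 t u : 0 < ctx_optimum t u.
Proof.
apply: prodr_gt0 => s _; apply: prodr_gt0 => m _; apply: exprn_gt0.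
by rewrite divr_gt0 ?rho_gt0// (rho_sum_gt0 t s).
Qed.

Lemma sum_ctx_optimum t : \sum_u ctx_optimum t u = 1.
Proof. by apply: (sum_ctx_path M_gt0 D_gt0) => s _; exact: sum_pi'. Qed.

(** The expected log-joint is finite for every [U], so the condition makes [q] proportional to the
    product of the [ctx_optimum]; that product already sums to 1, which fixes the constant. *)
Lemma is_optimal_qUP (q : {ffun {ffun 'I_n -> ctx M D} -> R}) :
  is_optimal_qU B piv q <-> forall U, q U = \prod_t ctx_optimum t (U t).
Proof.
have [C CE] := expect_q_joint.
(* Total unnormalised mass: each time contributes its message at the root. *)
pose Z := expR C * \prod_t message t troot.
have Z0 : 0 < Z by rewrite mulr_gt0 ?expR_gt0// prodr_gt0// => t _; exact: message_gt0.
have EE U : expR (C + \sum_t (ln (ctx_pmf B t (U t)) +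
    \sum_(s | anc s (ctx_leaf (U t))) star B piv t s)) =
    Z * \prod_t ctx_optimum t (U t).
  rewrite expRD /Z -mulrA; congr (_ * _); rewrite -big_split/= expR_sum.
  apply: eq_bigr => t _; rewrite expRD lnK ?posrE ?ctx_pmf_gt0//.
  exact: ctx_optimumE.
have w1 := sum_prod_ffun sum_ctx_optimum.
split=> [[[q0 q1] [c cE]] U|qE].
  have qE V : q V = expR c * Z * \prod_t ctx_optimum t (V t).
    have := cE V; rewrite CE -EFinD.
    (* [q V = 0] is impossible, since its logarithm would be [-oo] while the right-hand side is
       finite. *)
    have := q0 V; rewrite le_eqVlt => /predU1P[<-|qV]; first by rewrite le0_lneNy.
    rewrite lne_EFin// => -[] /(congr1 expR); rewrite lnK// => ->.
    by rewrite expRD EE mulrC mulrA.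
  have : expR c * Z = 1.
    by rewrite -q1; under [RHS]eq_bigr do rewrite qE; rewrite -mulr_sumr w1 mulr1.
  by move=> cZ; rewrite qE cZ mul1r.
have p0 U : 0 < \prod_t ctx_optimum t (U t).
  by apply: prodr_gt0 => t _; exact: ctx_optimum_gt0.
split; first split.
- by move=> U; rewrite qE ltW.
- by under eq_bigr do rewrite qE.
exists (- ln Z) => U; rewrite CE -EFinD qE lne_EFin//; congr EFin.
by apply: expR_inj; rewrite expRD EE lnK ?posrE// expRN lnK// mulrAC divff ?mul1r// gt_eqF.
Qed.

End Optimum.

Theorem proposition1 (R : realType) (M D J K n : nat)
    (M_gt0 : (0 < M)%N) (D_gt0 : (0 < D)%N) (J_gt0 : (0 < J)%N)
    (K_gt0 : (0 < K)%N) (n_gt0 : (0 < n)%N)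
    (B : softBCT R M D J K n)
    (piv : 'I_n -> node M D -> 'I_M -> R)
    (piv_ge0 : forall t s m, inner s -> 0 <= piv t s m)
    (piv_sum1 : forall t s, inner s -> \sum_(m < M) piv t s m = 1) :
  (exists! q : {ffun {ffun 'I_n -> ctx M D} -> R}, is_optimal_qU B piv q) /\
  (forall q : {ffun {ffun 'I_n -> ctx M D} -> R}, is_optimal_qU B piv q ->
    (forall U : {ffun 'I_n -> ctx M D},
       q U = \prod_(t < n) marginal q t (U t)) /\
    (forall (t : 'I_n) (u : ctx M D),
       marginal q t u
       = \prod_(s : node M D | inner s) \prod_(m < M)
           pi' B piv t s m ^+ (anc (child s m) (ctx_leaf u)))).
Proof.
have optP := is_optimal_qUP B piv_ge0 M_gt0 D_gt0.
split.
  exists [ffun U : {ffun 'I_n -> ctx M D} => \prod_t ctx_optimum B piv t (U t)]; split.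
    by apply/optP => U; rewrite ffunE.
  by move=> q /optP qE; apply/ffunP => U; rewrite ffunE qE.
move=> q /optP qE.
have mE t u : marginal q t u = ctx_optimum B piv t u.
  rewrite /marginal; under eq_bigr do rewrite qE.
  exact/sum_prod_ffun_at/(sum_ctx_optimum B piv M_gt0 D_gt0).
by split => [U|t u]; [rewrite qE; apply: eq_bigr => t _; rewrite mE | rewrite mE].
Qed.
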